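(* Let $\Omega\subset\mathbb{R}^n$ be a non-empty, bounded, open set, let $W:\mathbb{R}\times\mathbb{R}\to\mathbb{R}$ be lower semicontinuous and coercive, i.e., $W(\xi,\zeta)\to\infty$ as $|(\xi,\zeta)|\to\infty$, and let $$J(u):=\operatorname*{ess\,sup}_{(x,y)\in\Omega\times\Omega} W(u(x),u(y)),\qquad u\in L^\infty(\Omega).$$ Let $\widehat W:\mathbb{R}\times\mathbb{R}\to\mathbb{R}$ be the diagonalized and symmetrized version of $W$ (defined in the context). (i) The functional $J$ is $L^\infty$-weakly$^\ast$ lower semicontinuous if and only if $\widehat W$ is separately level convex. (ii) The relaxation of $J$, $$J^{\rm rlx}(u):=\inf\{\liminf_{j\to\infty}J(u_j): u_j\rightharpoonup^\ast u\text{ in }L^\infty(\Omega)\},\qquad u\in L^\infty(\Omega),$$ is given by $$J^{\rm rlx}(u)=\operatorname*{ess\,sup}_{(x,y)\in\Omega\times\Omega}\widehat W^{\rm slc}(u(x),u(y)),\qquad u\in L^\infty(\Omega),$$ where $\widehat W^{\rm slc}$ is the separately level convex envelope of $\widehat W$.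
   Context: For $c\in\mathbb{R}$, $L_c(W):=\{(\xi,\zeta): W(\xi,\zeta)\le c\}$. For $E\subset\mathbb{R}\times\mathbb{R}$, $\widehat E:=\{(\xi,\zeta)\in E:(\xi,\xi),(\zeta,\xi),(\zeta,\zeta)\in E\}$. The function $\widehat W$ is defined by $\widehat W(\xi,\zeta):=\inf\{c\in\mathbb{R}:(\xi,\zeta)\in\widehat{L_c(W)}\}$. A set $E\subset\mathbb{R}\times\mathbb{R}$ is separately convex if for all $t\in(0,1)$ and all $(\xi_1,\zeta_1),(\xi_2,\zeta_2)\in E$ with $\xi_1=\xi_2$ or $\zeta_1=\zeta_2$ one has $t(\xi_1,\zeta_1)+(1-t)(\xi_2,\zeta_2)\in E$. A function $V:\mathbb{R}\times\mathbb{R}\to\mathbb{R}\cup\{\infty\}$ is separately level convex if all its sublevel sets $L_c(V)$, $c\in\mathbb{R}$, are separately convex. The separately level convex envelope $V^{\rm slc}$ is the largest separately level convex function below $V$. $J$ takes values in $\mathbb{R}\cup\{\infty\}$. $L^\infty$-weakly$^\ast$ lower semicontinuous means: $J(u)\le\liminf_{j\to\infty}J(u_j)$ whenever $u_j\rightharpoonup^\ast u$ in $L^\infty(\Omega)$. *)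

(* Defs.v *)
From HB Require Import structures.
From mathcomp Require Import all_boot all_order all_algebra.
From mathcomp Require Import all_classical all_reals all_analysis.
From mathcomp Require Import measurable_realfun ess_sup_inf.

Set Implicit Arguments.
Unset Strict Implicit.
Unset Printing Implicit Defensive.

Import Order.TTheory GRing.Theory Num.Def Num.Theory.
Import numFieldNormedType.Exports.

Local Open Scope classical_set_scope.
Local Open Scope ring_scope.

(* MathComp-Analysis has no Lebesgue measure on 'rV[R]_n: we equip matrices
   with their Borel sigma-algebra and push lebesgue_measure \x mu forward along
   (x, v) |-> row_mx x v, starting from the Dirac mass on the point 'rV[R]_0. *)
Section borel_matrix.
Context {R : realType} (m n : nat).

HB.instance Definition _ := @isMeasurable.Build
  (sigma_display (@open 'M[R]_(m, n))) 'M[R]_(m, n)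
  <<s @open 'M[R]_(m, n) >> (@sigma_algebra0 _ setT _) (@sigma_algebraC _ _)
  (@sigma_algebra_bigcup _ setT _).

Lemma open_measurable_mx (A : set 'M[R]_(m, n)) : open A -> measurable A.
Proof. exact: sub_sigma_algebra. Qed.

Lemma measurable_coord (i : 'I_m) (j : 'I_n) :
  measurable_fun [set: 'M[R]_(m, n)] (fun M => M i j : R).
Proof.
apply: (measurability _ (RGenOpens.measurableE R)).
move=> _ [_ [a [b ->]] <-]; rewrite setTI; apply: open_measurable_mx.
by apply: open_comp; [move=> + _; exact: coord_continuous|exact: interval_open].
Qed.

Let rat_box (p : 'M[rat]_(m, n) * rat) : set 'M[R]_(m, n) :=
  [set M | forall i j, `|ratr (p.1 i j) - M i j| < ratr p.2].

Let open_rat_boxE (A : set 'M[R]_(m, n)) : open A ->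
  A = \bigcup_(p in [set p | rat_box p `<=` A]) rat_box p.
Proof.
move=> oA; apply/seteqP; split=> [M AM|M [p pA]]; last exact: pA.
have /nbhs_ballP[e /= e0 eA] : nbhs M A by exact: open_nbhs_nbhs.
have [q qe] : exists q, ratr q \in `]0, (e / 2)[.
  by apply: rat_in_itvoo; rewrite divr_gt0.
move: qe; rewrite in_itv/= => /andP[q0 qe].
have /choice[f fP] : forall ij : 'I_m * 'I_n, exists r : rat,
    ratr r \in `]M ij.1 ij.2 - ratr q, (M ij.1 ij.2 + ratr q)[.
  by move=> ij; apply: rat_in_itvoo; rewrite ltrBlDr -addrA ltrDl addr_gt0.
exists (\matrix_(i, j) f (i, j), q) => /=; last first.
  move=> i j /=; rewrite mxE; have := fP (i, j).
  by rewrite in_itv/= distrC ltr_distlC.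
move=> N /= Npq; apply: eA; split => // i j.
rewrite /ball/= (le_lt_trans (ler_distD (ratr (f (i, j))) _ _))//.
rewrite [ltRHS]splitr ltrD// ?(lt_trans _ qe)//.
  have := fP (i, j); rewrite in_itv/= -ltr_distlC.
  by rewrite distrC.
by have := Npq i j; rewrite mxE.
Qed.

Lemma measurable_fun_mxP d (T : measurableType d) (f : T -> 'M[R]_(m, n)) :
  measurable_fun setT f <->
  forall i j, measurable_fun setT (fun x => f x i j : R).
Proof.
split=> [mf i j|mf]; first exact: (measurableT_comp (measurable_coord i j) mf).
apply: (@measurability _ _ _ _ setT f (@open 'M[R]_(m, n))) => //.
move=> _ [A oA <-]; rewrite setTI (open_rat_boxE oA) preimage_bigcup.
rewrite bigcup_mkcond; apply: countable_bigcupT_measurable => // p.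
case: ifP => // _; rewrite /rat_box.
rewrite (_ : _ @^-1` _ = \bigcap_(ij in [set: 'I_m * 'I_n])
   ((fun x => `|ratr (p.1 ij.1 ij.2) - f x ij.1 ij.2| : R) @^-1`
      `]-oo, (ratr p.2 : R)[%classic)).
  apply: fin_bigcap_measurable => // -[i j] _.
  rewrite -[X in measurable X]setTI.
  have : measurable_fun setT (fun x => `|ratr (p.1 i j) - f x i j| : R).
    by apply: measurableT_comp => //; apply: measurable_funB => //; exact: mf.
  exact.
apply/seteqP; split => x /= h; first by move=> [i j] _; rewrite /= in_itv/=; exact: h.
by move=> i j; have := h (i, j) I; rewrite /= in_itv/=.
Qed.

End borel_matrix.

Section lebesgue_rV.
Context {R : realType}.

Definition rV_cons n (p : measurableTypeR R * 'rV[R]_n) : 'rV[R]_n.+1 :=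
  row_mx (p.1%:M : 'rV[R]_1) p.2.

Let rV_cons0 n p : @rV_cons n p ord0 ord0 = p.1.
Proof.
have -> : @ord0 n = lshift n (@ord0 0) by exact/val_inj.
by rewrite [LHS]row_mxEl mxE eqxx.
Qed.

Let rV_consS n p (j : 'I_n) : @rV_cons n p ord0 (lift ord0 j) = p.2 ord0 j.
Proof.
have -> : lift ord0 j = rshift 1 j by exact/val_inj.
by rewrite [LHS]row_mxEr.
Qed.

Let measurable_rV_cons n : measurable_fun setT (@rV_cons n).
Proof.
apply/measurable_fun_mxP => i j; rewrite (ord1 i).
case: (unliftP ord0 j) => [k ->|->].
  under eq_fun do rewrite rV_consS.
  exact: (measurableT_comp (measurable_coord ord0 k) measurable_snd).
by under eq_fun do rewrite rV_cons0; exact: measurable_fst.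
Qed.

HB.instance Definition _ n := @isMeasurableFun.Build _ _ _ _ (@rV_cons n)
  (@measurable_rV_cons n).

Section step.
Variables (n : nat) (mu : {sigma_finite_measure set 'rV[R]_n -> \bar R}).

Definition lebesgue_rVS : set 'rV[R]_n.+1 -> \bar R :=
  pushforward (lebesgue_measure \x mu)%E (@rV_cons n).

Let lebesgue_rVS0 : lebesgue_rVS set0 = 0%E. Proof. exact: measure0. Qed.

Let lebesgue_rVS_ge0 A : (0 <= lebesgue_rVS A)%E. Proof. exact: measure_ge0. Qed.

Let lebesgue_rVS_sigma_additive : semi_sigma_additive lebesgue_rVS.
Proof. exact: measure_semi_sigma_additive. Qed.

HB.instance Definition _ := isMeasure.Build _ _ _ lebesgue_rVS
  lebesgue_rVS0 lebesgue_rVS_ge0 lebesgue_rVS_sigma_additive.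

Let lebesgue_rVS_sigma_finite : sigma_finite setT lebesgue_rVS.
Proof.
have /sigma_finiteP[F [TF ndF Foo]] := sigma_finiteT (@lebesgue_measure R).
have /sigma_finiteP[G [TG ndG Goo]] := sigma_finiteT mu.
pose hd (v : 'rV[R]_n.+1) : measurableTypeR R := v ord0 ord0.
pose tl (v : 'rV[R]_n.+1) : 'rV[R]_n := \row_j v ord0 (lift ord0 j).
have mhd : measurable_fun setT hd by exact: measurable_coord.
have mtl : measurable_fun setT tl.
  apply/measurable_fun_mxP => i j; under eq_fun do rewrite mxE.
  exact: measurable_coord.
exists (fun k => hd @^-1` F k `&` tl @^-1` G k).
  apply/esym; rewrite -subTset => v _.
  have [i _ Fi] : (\bigcup_k F k) (hd v) by rewrite -TF.
  have [j _ Gj] : (\bigcup_k G k) (tl v) by rewrite -TG.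
  exists (maxn i j) => //; split.
    by have /subsetPset := ndF _ _ (leq_maxl i j); exact.
  by have /subsetPset := ndG _ _ (leq_maxr i j); exact.
move=> k; have [mF Fk] := Foo k; have [mG Gk] := Goo k; split.
  by apply: measurableI; rewrite -[X in measurable X]setTI; [exact: mhd|exact: mtl].
rewrite /lebesgue_rVS /pushforward (_ : _ @^-1` _ = F k `*` G k).
  by rewrite product_measure1E// lte_mul_pinfty// ge0_fin_numE.
apply/seteqP; split=> -[x v]; rewrite /= /hd /tl rV_cons0;
  by rewrite (_ : \row_j _ = v)//; apply/rowP => j; rewrite mxE rV_consS.
Qed.

HB.instance Definition _ := Measure_isSigmaFinite.Build _ _ _ lebesgue_rVS
  lebesgue_rVS_sigma_finite.

End step.

Fixpoint lebesgue_rV n : {sigma_finite_measure set 'rV[R]_n -> \bar R} :=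
  if n is m.+1 then lebesgue_rVS (lebesgue_rV m) else \d_(0 : 'rV[R]_0).

Lemma lebesgue_rV_box n (a b : 'rV[R]_n) : (forall i, a ord0 i <= b ord0 i) ->
  lebesgue_rV n [set v | forall i, v ord0 i \in `[a ord0 i, b ord0 i]] =
  (\prod_(i < n) (b ord0 i - a ord0 i))%:E.
Proof.
elim: n a b => [|n IHn] a b ab /=.
  by rewrite big_ord0 diracE mem_set//= => -[].
rewrite big_ord_recl EFinM.
pose tl (v : 'rV[R]_n.+1) : 'rV[R]_n := \row_j v ord0 (lift ord0 j).
have mB : measurable
    [set v : 'rV[R]_n | forall i, v ord0 i \in `[tl a ord0 i, tl b ord0 i]].
  rewrite [X in measurable X](_ : _ = \bigcap_(i in [set: 'I_n])
     (fun v : 'rV[R]_n => v ord0 i : measurableTypeR R) @^-1`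
       `[tl a ord0 i, tl b ord0 i]%classic); last first.
    by apply/seteqP; split => [v h i _|v h i]; exact: h.
  apply: fin_bigcap_measurable => // i _; rewrite -[X in measurable X]setTI.
  exact: measurable_coord.
have -> : (\prod_(i < n) (b ord0 (lift ord0 i) - a ord0 (lift ord0 i)))%:E =
    lebesgue_rV n [set v | forall i, v ord0 i \in `[tl a ord0 i, tl b ord0 i]].
  by rewrite IHn => [|i]; [under [in RHS]eq_bigr do rewrite !mxE|rewrite !mxE].
have -> : (b ord0 ord0 - a ord0 ord0)%:E =
    lebesgue_measure `[a ord0 ord0, b ord0 ord0]%classic.
  rewrite lebesgue_measure_itv/= lte_fin.
  by case: ltgtP (ab ord0) => // -> _; rewrite subrr.
rewrite -product_measure1E//.
rewrite /lebesgue_rVS /pushforward; congr (product_measure1 _ _ _).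
apply/seteqP; split => -[x v] /= => [h|[hx hv] i].
  split; first by have := h ord0; rewrite rV_cons0.
  by move=> i; have := h (lift ord0 i); rewrite rV_consS !mxE.
case: (unliftP ord0 i) => [k ->|->]; last by rewrite rV_cons0.
by have := hv k; rewrite rV_consS !mxE.
Qed.

End lebesgue_rV.

Section supremal_functionals.
Context d (T : measurableType d) (R : realType).
Variables (mu : {sigma_finite_measure set T -> \bar R}) (D : set T).
Implicit Types (u : T -> R) (v : nat -> T -> R).

(* Functions stand for their a.e. classes on D: patching with -oo outside D turns
   ess_sup into the essential supremum over D. *)
Definition Linfty u :=
  measurable_fun D u /\
  (ess_sup mu (patch (fun=> -oo%E) D (fun x => `|u x|%:E)) < +oo)%E.

Definition weak_star_cvg v u := forall phi : T -> R,
  mu.-integrable D (EFin \o phi) ->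
  \int[mu]_(x in D) (v j x * phi x) @[j --> \oo] -->
  \int[mu]_(x in D) (u x * phi x).

Definition weak_star_lsc (J : (T -> R) -> \bar R) := forall v u,
  (forall j, Linfty (v j)) -> Linfty u -> weak_star_cvg v u ->
  (J u <= limn_einf (fun j => J (v j)))%E.

Definition relaxation (J : (T -> R) -> \bar R) u : \bar R :=
  ereal_inf [set limn_einf (fun j => J (v j)) | v in
    [set v | (forall j, Linfty (v j)) /\ weak_star_cvg v u]].

Definition supremal (V : R * R -> \bar R) u : \bar R :=
  ess_sup (mu \x mu)%E
    (patch (fun=> -oo%E) (D `*` D) (fun p => V (u p.1, u p.2))).

Lemma supremalE V u : supremal V u = ereal_inf [set y |
  {ae (mu \x mu)%E, forall p, D p.1 -> D p.2 -> (V (u p.1, u p.2) <= y)%E}].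
Proof.
rewrite /supremal /ess_sup; congr ereal_inf.
apply/seteqP; split=> y /=; apply: filterS => p; rewrite /patch.
  by case: ifPn => [_ //|/negP]; rewrite inE/= => h _ d1 d2; case: h.
by case: ifPn => [|_ _]; [rewrite inE => -[a b] /(_ a b)|rewrite leNye].
Qed.

End supremal_functionals.

Section level_convexity.
Context {R : realType}.
Implicit Types (E : set (R * R)) (W : R * R -> R) (V : R * R -> \bar R).

Definition coercive W :=
  forall M : R, exists r : R, forall p, r < `|p| -> M < W p.

Definition sublevel V (c : R) : set (R * R) := [set p | (V p <= c%:E)%E].

Definition diag_sym_set E : set (R * R) :=
  [set p | [/\ E p, E (p.1, p.1), E (p.2, p.1) & E (p.2, p.2)]].

(* W being real-valued, the set below is non-empty and bounded below by W p, so
   that the infimum is the genuine one. *)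
Definition diag_sym W (p : R * R) : R :=
  inf [set c | diag_sym_set (sublevel (EFin \o W) c) p].

Definition separately_convex E := forall (t : R) (p q : R * R),
  0 < t < 1 -> E p -> E q -> p.1 = q.1 \/ p.2 = q.2 ->
  E (t * p.1 + (1 - t) * q.1, t * p.2 + (1 - t) * q.2).

(* The first conjunct expresses that V takes its values in R `|` {+oo}. *)
Definition separately_level_convex V :=
  (forall p, V p != -oo%E) /\ (forall c, separately_convex (sublevel V c)).

Definition slc_envelope V Vslc :=
  [/\ separately_level_convex Vslc,
      forall p, (Vslc p <= V p)%E &
      forall G, separately_level_convex G -> (forall p, (G p <= V p)%E) ->
        forall p, (G p <= Vslc p)%E].

End level_convexity.

(* Main.v *)
Require Import Defs.
From mathcomp Require Import all_boot all_order all_algebra.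
From mathcomp Require Import all_classical all_reals all_analysis.
From mathcomp Require Import measurable_realfun ess_sup_inf ring lra.
Import Order.TTheory GRing.Theory Num.Theory.
Import numFieldNormedType.Exports.
Import HBSimple.

Set Implicit Arguments.
Unset Strict Implicit.
Unset Printing Implicit Defensive.

Local Open Scope classical_set_scope.
Local Open Scope ring_scope.

(** Write V for [diag_sym W]. Since W is real-valued, V (x, y) is the maximum of
    W over the four pairs with entries in {x, y}; it is symmetric, and V (a, b)
    bounds W on {a, b} x {a, b}.

    The envelope of V is explicit: [square_envelope V p] is the infimum of
    V (a, b) over the squares [a, b]^2 that contain p. Its sublevel sets are
    unions of squares centred on the diagonal, and such a union is separately
    convex because two squares that meet a common horizontal or vertical line
    share a diagonal point of that line ([itv_convex_union]). Conversely a
    separately convex set containing the four corners of a square contains the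
    square, which gives maximality ([square_envelopeP]). Lower semicontinuity and
    coercivity make the infimum a minimum ([diag_sym_attained]).

    Let u be bounded, with essential infimum al and essential supremum be. The
    envelope grows with the gap between its arguments, so its supremal
    functional at u is its value at (al, be) ([supremal_square_envelope]). If
    J u <= c, then evaluating near the essential values al and be yields
    V (al, be) <= c by lower semicontinuity ([supremal_diag_sym_le]). Both
    inequalities of the relaxation formula thus concern al and be only.

    Lower bound ([limn_einf_supremal_ge]): if v_j converges weakly* to u, testing
    with the indicators of {|u - al| < e} and {|u - be| < e} shows that, up to e,
    the essential bounds a_j, b_j of v_j eventually enclose al and be. As
    V (a_j, b_j) is at most any bound on J (v_j), compactness gives in the limit
    a pair that encloses al and be and satisfies the same bound.

    Upper bound ([recovery_sequence]): if V (a, b) <= c and a <= al <= be <= b,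
    then u is the weak* limit of functions with values in {a, b}, and J is at
    most V (a, b) on these. To construct them ([two_valued_approximation]), fix a
    sequence of sets generating the sigma-algebra; on each cell of the finite
    partition defined by the first j of them, let v_j be b where the first
    coordinate is below a threshold and a elsewhere, the threshold being chosen
    by the intermediate value theorem so that v_j and u have the same integral
    over the cell. Then v_j - u integrates to zero, for large j, over every set of
    a generating pi-system; the pi-lambda theorem extends the convergence to all
    measurable sets, and density of the simple functions extends it to all
    integrable test functions ([null_test_integrable]).

    The characterization of lower semicontinuity follows. If V is separately
    level convex it is its own envelope, so the supremal functional of V, which
    bounds J from above, is the relaxation of J. If J is lower semicontinuous,
    then J is at most its relaxation at a function taking the values x and y on
    sets of positive measure, which forces V (x, y) to be at most the envelope of
    V at (x, y).

    The Euclidean space enters only at the end, where it supplies what the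
    argument asks of the domain: a finite positive measure, a countable family
    generating the sigma-algebra, and a bounded function whose law has a bounded
    density, namely the first coordinate. *)

(** * Diagonalization, symmetrization and the separately level convex envelope *)

Section level_convexity.
Context {R : realType}.
Implicit Types (W : R * R -> R) (p q : R * R) (c : R).

(** [diag_sym W p] is the maximum of W over the four pairs of coordinates of
    [p]. *)
Lemma diag_sym_le W p c : diag_sym W p <= c <->
  [/\ W p <= c, W (p.1, p.1) <= c, W (p.2, p.1) <= c & W (p.2, p.2) <= c].
Proof.
set P := (X in _ <-> X).
set A := [set c | diag_sym_set (sublevel (EFin \o W) c) p].
pose m := Num.max (Num.max (W p) (W (p.1, p.1)))
                  (Num.max (W (p.2, p.1)) (W (p.2, p.2))).
have Pm x : A x <-> m <= x.
  rewrite /m !ge_max /A /diag_sym_set /sublevel /= !lee_fin.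
  by split=> [[-> -> -> ->]//|/andP[/andP[-> ->] /andP[-> ->]]].
have -> : diag_sym W p = m.
  apply/eqP; rewrite eq_le; apply/andP; split.
    by apply: ge_inf; [exists m => x /Pm|exact/Pm].
  by apply: lb_le_inf; [exists m; exact/Pm|move=> x /Pm].
have -> : P <-> A c.
  by rewrite /P /A /diag_sym_set /sublevel /= !lee_fin; split=> -[].
by split => /Pm.
Qed.

Lemma diag_symC W p : diag_sym W (p.2, p.1) = diag_sym W p.
Proof.
have symW q : diag_sym W (q.2, q.1) <= diag_sym W q.
  have /diag_sym_le[] := lexx (diag_sym W q); case: q => a b /= *.
  exact/diag_sym_le.
by apply/eqP; rewrite eq_le symW/=; case: p => a b; exact: (symW (b, a)).
Qed.

Lemma lsc_comp (X Y : topologicalType) (f : Y -> \bar R) (g : X -> Y) :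
  continuous g -> lower_semicontinuous f -> lower_semicontinuous (f \o g).
Proof.
move=> cg lf x a /= /lf[V Vx Va]; exists (g @^-1` V); last by move=> y /Va.
exact: (cg x).
Qed.

Lemma continuous_lsc (X : topologicalType) (f : X -> R) :
  continuous f -> lower_semicontinuous (EFin \o f).
Proof.
move=> cf x a /=; rewrite lte_fin => afx.
exists (f @^-1` [set y | a < y]) => //.
apply: (cf x); exact: lt_nbhsr.
Qed.

Lemma bounded_cluster (q : nat -> R * R) (M : R) :
  (forall k, `|q k| <= M) -> exists p, cluster (q @ \oo) p.
Proof.
move=> qM.
have K := compact_setX (@segment_compact _ (- M) M) (@segment_compact _ (- M) M).
have [|p [_ clp]] := K (q @ \oo) _; last by exists p.
exists 0%N => // k _ /=; have := qM k.
by rewrite /= !in_itv/= prod_normE ge_max !ler_norml => /andP[].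
Qed.

(** A lower semicontinuous function passes upper bounds to cluster points. *)
Lemma cluster_lsc_le (f : R * R -> R) (q : nat -> R * R) p c :
  lower_semicontinuous (EFin \o f) -> cluster (q @ \oo) p ->
  (forall k, f (q k) <= c + k.+1%:R^-1) -> f p <= c.
Proof.
move=> lf clp fq; apply/ler_addgt0Pr => e e0; rewrite leNgt; apply/negP => cf.
have [V Vp Vc] := lf p (c + e) cf.
have [k] : exists k : nat, k.+1%:R^-1 < e.
  have [N _ NP] := near_infty_natSinv_lt (PosNum e0).
  by exists N; exact: (NP N (leqnn N)).
move=> ke.
have [|x [[j /= kj <-] Vqj]] := clp (q @` [set j | (k <= j)%N]) V _ Vp.
  by exists k => // j kj /=; exists j.
have := Vc _ Vqj; rewrite /= lte_fin; apply/negP; rewrite -leNgt.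
apply: (le_trans (fq j)); rewrite lerD2l; apply: ltW; apply: le_lt_trans ke.
by rewrite lef_pV2 ?posrE// ler_nat.
Qed.

(** The direct method: if, for every tolerance [e], some pair encloses the
    interval [al, be] and has value at most [c] up to [e], then some pair does so
    exactly. No relation between [al] and [be] is assumed. *)
Lemma diag_sym_attained W (al be c : R) :
  lower_semicontinuous (EFin \o W) -> coercive W ->
  (forall e, 0 < e -> exists q,
     [/\ q.1 <= al + e, be - e <= q.2 & diag_sym W q <= c + e]) ->
  exists q, [/\ q.1 <= al, be <= q.2 & diag_sym W q <= c].
Proof.
move=> lW cW H.
have /choice[q qP] : forall k : nat, exists q, [/\ q.1 <= al + k.+1%:R^-1,
    be - k.+1%:R^-1 <= q.2 & diag_sym W q <= c + k.+1%:R^-1].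
  by move=> k; apply: H; rewrite invr_gt0.
have Wq k : W (q k) <= c + 1.
  have [_ _ /diag_sym_le[+ _ _ _]] := qP k; move=> /le_trans; apply.
  by rewrite lerD2l invf_le1 ?ltr0n ?ler1n.
have [r rP] := cW (c + 1).
have [p clp] : exists p, cluster (q @ \oo) p.
  apply: (@bounded_cluster _ r) => k.
  by rewrite leNgt; apply/negP => /rP; rewrite ltNge Wq.
have cl_W (s : R * R -> R * R) : continuous s ->
    (forall k, W (s (q k)) <= c + k.+1%:R^-1) -> W (s p) <= c.
  by move=> cs; apply: (@cluster_lsc_le (W \o s)) => //; exact: (lsc_comp cs lW).
have c1 : continuous (@fst R R) by move=> ?; exact: cvg_fst.
have c2 : continuous (@snd R R) by move=> ?; exact: cvg_snd.
exists p; split.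
- apply: (@cluster_lsc_le fst q) => //; first exact: continuous_lsc.
  by move=> k; have [] := qP k.
- rewrite -lerN2; apply: (@cluster_lsc_le (fun x => - x.2) q) => //.
    by apply: continuous_lsc => x; apply: continuousN; exact: c2.
  by move=> k /=; have [_ + _] := qP k; rewrite lerNl opprD opprK.
- apply/diag_sym_le; split.
  + by apply: (cl_W id) => [x|k]; [exact: cvg_id|have [_ _ /diag_sym_le[]] := qP k].
  + apply: (cl_W (fun x => (x.1, x.1))) => [x|k].
      exact: (cvg_pair (c1 x) (c1 x)).
    by have [_ _ /diag_sym_le[]] := qP k.
  + apply: (cl_W (fun x => (x.2, x.1))) => [x|k].
      exact: (cvg_pair (c2 x) (c1 x)).
    by have [_ _ /diag_sym_le[]] := qP k.
  + apply: (cl_W (fun x => (x.2, x.2))) => [x|k].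
      exact: (cvg_pair (c2 x) (c2 x)).
    by have [_ _ /diag_sym_le[]] := qP k.
Qed.

(** The bound keeps the envelope away from minus infinity. *)
Lemma lsc_coercive_bounded_below W :
  lower_semicontinuous (EFin \o W) -> coercive W -> exists m, forall p, m <= W p.
Proof.
move=> lW cW; apply: contrapT => /forallNP H.
have /choice[q qP] : forall k : nat, exists q, W q < - k%:R.
  move=> k; apply: contrapT => /forallNP Hk; apply: (H (- k%:R)) => p.
  by rewrite leNgt; apply/negP/Hk.
have [r rP] := cW 0.
have [p clp] : exists p, cluster (q @ \oo) p.
  apply: (@bounded_cluster _ r) => k; rewrite leNgt; apply/negP => /rP.
  by apply/negP; rewrite -leNgt (le_trans (ltW (qP k)))// oppr_le0.
have [|V Vp VW] := lW p (W p - 1); first by rewrite /= lte_fin gtrBl.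
pose k := (Num.truncn `|W p - 1|).+1.
have [|x [[j /= kj <-] Vqj]] := clp (q @` [set j | (k <= j)%N]) V _ Vp.
  by exists k => // j kj /=; exists j.
have := VW _ Vqj; rewrite /= lte_fin; apply/negP; rewrite -leNgt.
apply: (le_trans (ltW (qP j))).
have : `|W p - 1| < j%:R by rewrite (lt_le_trans (truncnS_gt _))// ler_nat.
by rewrite ltr_norml => /andP[/ltW].
Qed.

(** The squares [a, b]^2 containing [p], each encoded by its corner (a, b). *)
Definition enclosing_square p : set (R * R) :=
  [set q | [/\ q.1 <= p.1, q.1 <= p.2, p.1 <= q.2 & p.2 <= q.2]].

(** The infimum of V over the corners of the squares containing [p]; it is the
    separately level convex envelope of V when V is [diag_sym W] for a lower
    semicontinuous and coercive W. *)
Definition square_envelope (V : R * R -> R) p : \bar R :=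
  ereal_inf [set (V q)%:E | q in enclosing_square p].

(** The infimum is attained. *)
Lemma square_envelope_leP W p c :
  lower_semicontinuous (EFin \o W) -> coercive W ->
  (square_envelope (diag_sym W) p <= c%:E)%E <->
  exists2 q, enclosing_square p q & diag_sym W q <= c.
Proof.
move=> lW cW; split=> [h|[q pq qc]]; last first.
  by apply: ge_ereal_inf; exists (diag_sym W q)%:E; [exists q|rewrite lee_fin].
have [|q [q1 q2 qc]] := @diag_sym_attained W (Num.min p.1 p.2) (Num.max p.1 p.2) c lW cW.
  move=> e e0; have : (square_envelope (diag_sym W) p < (c + e)%:E)%E.
    by apply: (le_lt_trans h); rewrite lte_fin ltrDl.
  move=> /ereal_inf_lt[_ [q [a b d f] <-]]; rewrite lte_fin => /ltW qc.
  exists q; split => //.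
    by rewrite (@le_trans _ _ (Num.min p.1 p.2)) ?le_min ?a ?b// lerDl ltW.
  by rewrite (@le_trans _ _ (Num.max p.1 p.2)) ?ge_max ?d ?f// gerBl ltW.
exists q => //; move: q1 q2; rewrite le_min ge_max => /andP[? ?] /andP[? ?].
by split.
Qed.


(** If two intervals have a common point [x], then every convex combination of a
    point of the first and a point of the second lies in one of them. *)
Lemma itv_convex_union (a b a' b' x u v t : R) : 0 < t < 1 ->
  a <= x <= b -> a' <= x <= b' -> a <= u <= b -> a' <= v <= b' ->
  (a <= t * u + (1 - t) * v <= b) \/ (a' <= t * u + (1 - t) * v <= b').
Proof.
set y := t * u + _ => t01 xab xab' uab vab'.
have [uv|vu] := leP u v.
  have uy : u <= y by rewrite /y; nra.
  have yv : y <= v by rewrite /y; nra.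
  by have [yx|xy] := leP y x; [left|right]; apply/andP; split; lra.
have vy : v <= y by rewrite /y; nra.
have yu : y <= u by rewrite /y; nra.
by have [yx|xy] := leP y x; [right|left]; apply/andP; split; lra.
Qed.

Lemma separately_convex_itv (E : set (R * R)) (x u y v : R) :
  separately_convex E -> u <= y <= v ->
  (E (x, u) -> E (x, v) -> E (x, y)) /\ (E (u, x) -> E (v, x) -> E (y, x)).
Proof.
move=> sE /andP[]; rewrite [u <= y]le_eqVlt => /predU1P[->//|uy].
rewrite [y <= v]le_eqVlt => /predU1P[->//|yv].
pose t := (v - y) / (v - u).
have vu0 : v - u != 0 by apply/lt0r_neq0; lra.
have t01 : 0 < t < 1.
  rewrite divr_gt0 ?subr_gt0//=; last by lra.
  by rewrite ltr_pdivrMr; lra.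
have xE : t * x + (1 - t) * x = x by lra.
have yE : t * u + (1 - t) * v = y.
  by rewrite /t; field.
split=> Eu Ev.
  by have := sE t (x, u) (x, v) t01 Eu Ev (or_introl erefl); rewrite /= xE yE.
by have := sE t (u, x) (v, x) t01 Eu Ev (or_intror erefl); rewrite /= xE yE.
Qed.

Lemma square_envelope_fin W p : lower_semicontinuous (EFin \o W) -> coercive W ->
  square_envelope (diag_sym W) p != -oo%E.
Proof.
move=> lW cW; have [m mW] := lsc_coercive_bounded_below lW cW.
suff : (m%:E <= square_envelope (diag_sym W) p)%E by case: square_envelope.
apply/le_ereal_inf_tmp => _ [q _ <-]; rewrite lee_fin (le_trans (mW q))//.
by have /diag_sym_le[] := lexx (diag_sym W q).
Qed.

Lemma square_envelope_le W p : (square_envelope (diag_sym W) p <= (diag_sym W p)%:E)%E.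
Proof.
apply: ge_ereal_inf; have [p12|p21] := leP p.1 p.2.
  by exists (diag_sym W p)%:E => //; exists p.
exists (diag_sym W p)%:E => //; exists (p.2, p.1); last by rewrite diag_symC.
by split => //=; apply: ltW.
Qed.

Lemma square_envelopeP W : lower_semicontinuous (EFin \o W) -> coercive W ->
  slc_envelope (EFin \o diag_sym W) (square_envelope (diag_sym W)).
Proof.
move=> lW cW; split; [split|exact: square_envelope_le|].
- by move=> p; exact: square_envelope_fin.
- move=> c t p q t01.
  rewrite /sublevel /= => /square_envelope_leP[//|//|s [s1 s2 s3 s4] sc].
  move=> /square_envelope_leP[//|//|s' [s1' s2' s3' s4'] sc'] pq.
  apply/square_envelope_leP => //.
  have [e|e] := pq.
    have xE : t * p.1 + (1 - t) * q.1 = p.1 by rewrite -e; lra.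
    have [||||/andP[y1 y2]|/andP[y1 y2]] := @itv_convex_union s.1 s.2 s'.1 s'.2 p.1 p.2 q.2 t t01.
    + by rewrite s1.
    + by rewrite e s1'.
    + by rewrite s2.
    + by rewrite s2'.
    + by exists s => //; split; rewrite /= ?xE.
    + by exists s' => //; split; rewrite /= ?xE ?e.
  have xE : t * p.2 + (1 - t) * q.2 = p.2 by rewrite -e; lra.
  have [||||/andP[y1 y2]|/andP[y1 y2]] := @itv_convex_union s.1 s.2 s'.1 s'.2 p.2 p.1 q.1 t t01.
  + by rewrite s2.
  + by rewrite e s2'.
  + by rewrite s1.
  + by rewrite s1'.
  + by exists s => //; split; rewrite /= ?xE.
  + by exists s' => //; split; rewrite /= ?xE ?e.
- move=> G [_ cG] GW p; apply/le_ereal_inf_tmp => _ [q [q1 q2 q3 q4] <-].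
  set c := diag_sym W q; have sc := cG c.
  (* [diag_sym W] is at most [c] at the four corners of the square, hence so is G,
     and separate convexity of its sublevel set fills the square. *)
  have /diag_sym_le[c1 c2 c3 c4] := lexx c.
  have Gle z : diag_sym W z <= c -> sublevel G c z.
    by rewrite /sublevel /= -lee_fin; apply: le_trans (GW z).
  have Eaa : sublevel G c (q.1, q.1) by apply: Gle; apply/diag_sym_le.
  have Eab : sublevel G c (q.1, q.2).
    by apply: Gle; apply/diag_sym_le; rewrite -surjective_pairing.
  have Eba : sublevel G c (q.2, q.1).
    by apply: Gle; apply/diag_sym_le; rewrite /= -surjective_pairing.
  have Ebb : sublevel G c (q.2, q.2) by apply: Gle; apply/diag_sym_le.
  have p1q : q.1 <= p.1 <= q.2 by rewrite q1.
  have p2q : q.1 <= p.2 <= q.2 by rewrite q2.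
  have Ea := (separately_convex_itv q.1 sc p1q).2 Eaa Eba.
  have Eb := (separately_convex_itv q.2 sc p1q).2 Eab Ebb.
  by have := (separately_convex_itv p.1 sc p2q).1 Ea Eb; rewrite -surjective_pairing.
Qed.

End level_convexity.

(** * Essential values and supremal functionals *)

Section ess_values.
Context d (T : measurableType d) (R : realType).
Variables (mu : {sigma_finite_measure set T -> \bar R}) (D : set T).
Hypothesis mD : measurable D.
Implicit Types u : T -> R.

Lemma Linfty_boundedP u : Linfty mu D u <->
  measurable_fun D u /\ exists M, {ae mu, forall x, D x -> `|u x| <= M}.
Proof.
rewrite /Linfty; set f := patch _ _ _; split=> -[meas_u H]; split=> //.
  have : {ae mu, forall x, (f x <= ess_sup mu f)%E} by exact: ess_sup_ge.
  case: (ess_sup mu f) H => [M _||_] // fM.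
    exists M; apply: filterS fM => x; rewrite /f /patch.
    by case: ifPn => [_|/negP]; rewrite ?lee_fin// inE => nDx.
  exists 0; apply: filterS fM => x; rewrite /f /patch.
  by case: ifPn => [_|/negP]; rewrite ?inE.
have [M HM] := H; apply: (@le_lt_trans _ _ M%:E); last exact: ltry.
apply/ess_supP; apply: filterS HM => x; rewrite /f /patch.
by case: ifPn => [|_ _]; [rewrite inE lee_fin => Dx /(_ Dx)|exact: leNye].
Qed.

Lemma ae_not_gt0 (A : set T) : measurable A ->
  {ae mu, forall x, ~ A x} -> mu A = 0%E.
Proof.
move=> mA [N [mN N0 AN]]; apply: (subset_measure0 mA mN _ N0).
by move=> x Ax; apply: AN; rewrite /= notE.
Qed.

Lemma measure0_ae_not (A : set T) : measurable A ->
  mu A = 0%E -> {ae mu, forall x, ~ A x}.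
Proof. by move=> mA A0; exists A; split => // x /=; rewrite notE. Qed.

(** [x] belongs to the essential range of [u] on [D]. *)
Definition ess_value u (x : R) := forall e, 0 < e ->
  (0 < mu (D `&` [set t | (`|u t - x| < e)%R]))%E.

Lemma measurable_dist_lt u (x e : R) : measurable_fun D u ->
  measurable (D `&` [set t | `|u t - x| < e]).
Proof.
move=> meas_u; have : measurable_fun D (fun t => `|u t - x|).
  by apply: measurableT_comp => //; apply: measurable_funB.
move=> /(_ mD `]-oo, e[%classic); rewrite (_ : _ @^-1` _ = [set t | `|u t - x| < e]).
  by apply.
by apply/seteqP; split=> t /=; rewrite in_itv.
Qed.

(** The essential supremum of [u] on [D] is an essential value. *)
Lemma ess_max_exists u : (0 < mu D)%E -> Linfty mu D u ->
  exists2 be, {ae mu, forall x, D x -> u x <= be} & ess_value u be.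
Proof.
move=> D0 /Linfty_boundedP[meas_u [M uM]].
pose S := [set t | {ae mu, forall x, D x -> u x <= t}].
have SM : S M by apply: filterS uM => x + Dx => /(_ Dx) /ler_normlW.
have Slb : has_lbound S.
  exists (- M) => t St; rewrite leNgt; apply/negP => tM.
  move: D0; rewrite (@ae_not_gt0 D) ?ltxx//.
  move: uM St; apply: filterS2 => x uxM uxt Dx.
  have := uxM Dx; rewrite ler_norml => /andP[+ _]; have := uxt Dx.
  by move=> h1 h2; have := lt_le_trans tM (le_trans h2 h1); rewrite ltxx.
have Sinf : has_inf S by split => //; exists M.
have ube : {ae mu, forall x, D x -> u x <= inf S}.
  have : {ae mu, forall x, forall k : nat, D x -> u x <= inf S + k.+1%:R^-1}.
    apply/ae_foralln => k.
    have k0 : 0 < k.+1%:R^-1 :> R by rewrite invr_gt0.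
    have [t St /ltW tS] := inf_adherent k0 Sinf.
    by apply: filterS St => x + Dx => /(_ Dx) /le_trans; apply.
  apply: filterS => x ux Dx; apply/ler_addgt0Pr => e e0.
  have [N _ NP] := near_infty_natSinv_lt (PosNum e0).
  by rewrite (le_trans (ux N Dx))// lerD2l ltW//; exact: (NP N (leqnn N)).
exists (inf S) => // e e0; rewrite lt0e measure_ge0 andbT; apply/negP => /eqP me0.
have H := measure0_ae_not (measurable_dist_lt _ _ meas_u) me0.
suff /ge_inf : S (inf S - e) by move=> /(_ Slb); lra.
move: H ube; apply: filterS2 => x nH ux Dx; rewrite leNgt; apply/negP => xe.
by apply: nH; split => //=; rewrite ltr_distlC; have := ux Dx; lra.
Qed.

(** The essential infimum, obtained from [- u]. *)
Lemma ess_min_exists u : (0 < mu D)%E -> Linfty mu D u ->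
  exists2 al, {ae mu, forall x, D x -> al <= u x} & ess_value u al.
Proof.
move=> D0 /Linfty_boundedP[meas_u [M uM]].
have [|be ube eube] := @ess_max_exists (fun x => - u x) D0.
  apply/Linfty_boundedP; split; first exact: measurableT_comp.
  by exists M; apply: filterS uM => x + Dx => /(_ Dx); rewrite normrN.
exists (- be); first by apply: filterS ube => x + Dx => /(_ Dx); rewrite lerNl.
move=> e e0; rewrite (_ : [set _ | _] = [set t | `|- u t - be| < e]); first exact: eube.
by apply/seteqP; split => t /=; rewrite -opprD normrN opprK.
Qed.

Let product_measureE (A B : set T) : measurable A -> measurable B ->
  (mu \x mu)%E (A `*` B) = (mu A * mu B)%E.
Proof. exact: product_measure1E. Qed.

Lemma ae_prod_conj (P : T -> Prop) : {ae mu, forall x, D x -> P x} ->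
  {ae (mu \x mu)%E, forall p : T * T, D p.1 -> D p.2 -> P p.1 /\ P p.2}.
Proof.
move=> [N [mN N0 PN]].
exists (N `*` setT `|` setT `*` N); split.
- by apply: measurableU; apply: measurableX.
- apply: (null_set_setU (measurableX mN measurableT) (measurableX measurableT mN)).
    by apply: (etrans (product_measureE mN measurableT)); rewrite N0 mul0e.
  by apply: (etrans (product_measureE measurableT mN)); rewrite N0 mule0.
- move=> p /= np; apply: contrapT => /not_orP[n1 n2]; apply: np => d1 d2.
  split; apply: contrapT => nP.
    by apply: n1; split => //; apply: PN => /= /(_ d1).
  by apply: n2; split => //; apply: PN => /= /(_ d2).
Qed.

(** A property that holds almost everywhere on the product holds somewhere on a
    rectangle with sides of positive measure. *)
Lemma ae_prod_witness (A B : set T) (Q : T * T -> Prop) :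
  measurable A -> measurable B -> (0 < mu A)%E -> (0 < mu B)%E ->
  {ae (mu \x mu)%E, forall p, Q p} -> exists p, [/\ A p.1, B p.2 & Q p].
Proof.
move=> mA mB A0 B0 [N [mN N0 QN]]; apply: contrapT => /forallNP nex.
have : ((mu \x mu) (A `*` B) <= 0)%E.
  rewrite -N0; apply: le_measure; rewrite ?inE//; first exact: measurableX.
  by move=> p [Ap Bp]; apply: QN => /= Qp; apply: (nex p).
by apply/negP; rewrite -ltNge (product_measureE mA mB) mule_gt0.
Qed.

Lemma supremal_leP (V : R * R -> \bar R) u y : (supremal mu D V u <= y)%E <->
  {ae (mu \x mu)%E, forall p : T * T, D p.1 -> D p.2 -> (V (u p.1, u p.2) <= y)%E}.
Proof.
rewrite /supremal; split=> [/ess_supP H|H]; last apply/ess_supP.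
  apply: filterS H => p; rewrite /patch.
  case: ifPn => [_ //|/negP]; rewrite inE => nD _ d1 d2; case: nD; split => //.
apply: filterS H => p; rewrite /patch.
by case: ifPn => [|_ _]; [rewrite inE => -[a b] /(_ a b)|exact: leNye].
Qed.

(** A bound on the supremal functional of a lower semicontinuous integrand holds
    at every pair of essential values, although such pairs may be negligible. *)
Lemma supremal_ess_value_le (W : R * R -> R) u x y c :
  lower_semicontinuous (EFin \o W) -> measurable_fun D u ->
  (supremal mu D (EFin \o W) u <= c%:E)%E ->
  ess_value u x -> ess_value u y -> W (x, y) <= c.
Proof.
move=> lW meas_u /supremal_leP H ux uy; rewrite leNgt; apply/negP => cW.
have [V Vxy VW] := lW (x, y) c cW.
have [e /= e0 eV] := (nbhs_ballP _ _).1 Vxy.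
have [p [[p1 /= xp1] [p2 /= xp2] /(_ p1 p2)]] := ae_prod_witness
  (measurable_dist_lt x e meas_u) (measurable_dist_lt y e meas_u) (ux e e0) (uy e e0) H.
have /VW /= : V (u p.1, u p.2).
  by apply: eV; split; rewrite /= /ball /= distrC.
by rewrite !lte_fin lee_fin => /lt_le_trans h /h; rewrite ltxx.
Qed.

Lemma supremal_diag_sym_le (W : R * R -> R) u x y c :
  lower_semicontinuous (EFin \o W) -> measurable_fun D u ->
  (supremal mu D (EFin \o W) u <= c%:E)%E ->
  ess_value u x -> ess_value u y -> diag_sym W (x, y) <= c.
Proof.
move=> lW meas_u H ux uy.
by apply/diag_sym_le; split; apply: (supremal_ess_value_le lW meas_u H).
Qed.

Lemma ereal_le_realP (a b : \bar R) :
  (forall c : R, (b <= c%:E)%E -> (a <= c%:E)%E) -> (a <= b)%E.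
Proof.
case: b => [r||] H; [exact: H|exact: leey|].
case: a H => [a||] // H; last by have := H 0 (leNye _).
by exfalso; have := H (a - 1) (leNye _); rewrite lee_fin; lra.
Qed.

(** The supremal functional of a square envelope is the value of the envelope at
    the pair (ess inf u, ess sup u). *)
Lemma supremal_square_envelope (W : R * R -> R) u al be :
  lower_semicontinuous (EFin \o W) -> coercive W -> measurable_fun D u ->
  {ae mu, forall x, D x -> al <= u x <= be} ->
  ess_value u al -> ess_value u be ->
  supremal mu D (square_envelope (diag_sym W)) u =
  square_envelope (diag_sym W) (al, be).
Proof.
move=> lW cW meas_u uab ual ube; apply/eqP; rewrite eq_le; apply/andP; split.
  apply/supremal_leP; move: (ae_prod_conj uab); apply: filterS => p + d1 d2.
  move=> /(_ d1 d2)[/andP[a1 b1] /andP[a2 b2]].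
  apply: ereal_inf_le_tmp => _ [q [q1 q2 q3 q4] <-] /=; exists q => //.
  by split => //=; [exact: le_trans q1 a1|exact: le_trans q1 a2|exact: le_trans b1 q4|exact: le_trans b2 q4].
apply: ereal_le_realP => c /supremal_leP H.
have [e e0|q [qa qb qc]] := @diag_sym_attained _ W al be c lW cW.
  have [p [[p1 /= xp1] [p2 /= xp2] /(_ p1 p2) +]] := ae_prod_witness
    (measurable_dist_lt al e meas_u) (measurable_dist_lt be e meas_u) (ual e e0) (ube e e0) H.
  move=> /square_envelope_leP[//|//|q [q1 q2 q3 q4] qc].
  exists q; split => //; last by rewrite (le_trans qc)// lerDl ltW.
    apply: (le_trans q1) => /=; move: xp1; rewrite ltr_distl => /andP[_ /ltW]//.
  by apply: le_trans q4 => /=; move: xp2; rewrite ltr_distl => /andP[/ltW].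
apply/square_envelope_leP => //; exists q => //.
have alb : al <= be.
  apply/ler_addgt0Pr => e e0.
  have uab2 : {ae (mu \x mu)%E, forall p : T * T, D p.1 -> D p.2 ->
     al <= u p.1 <= be /\ al <= u p.2 <= be} by exact: (ae_prod_conj uab).
  have [p [[p1 /= _] [p2 /= _] /(_ p1 p2)]] := ae_prod_witness
    (measurable_dist_lt al e meas_u) (measurable_dist_lt be e meas_u) (ual e e0) (ube e e0) uab2.
  by move=> [/andP[h1 h2] _]; rewrite (le_trans h1)// (le_trans h2)// lerDl ltW.
by split => //=; [exact: le_trans qa alb|exact: le_trans alb qb].
Qed.

End ess_values.

(** * Weak* limits and the lower bound *)

Section weak_star_bounds.
Context d (T : measurableType d) (R : realType).
Variables (mu : {sigma_finite_measure set T -> \bar R}) (D : set T).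
Hypotheses (mD : measurable D) (Dfin : (mu D < +oo)%E).
Implicit Types u f g phi : T -> R.

(** Essential boundedness of [f] suffices. *)
Lemma integrable_LinftyM f phi : Linfty mu D f ->
  mu.-integrable D (EFin \o phi) ->
  mu.-integrable D (EFin \o (fun x => f x * phi x)).
Proof.
move=> /Linfty_boundedP[mf [M fM]] iphi.
have mphi : measurable_fun D phi by apply/measurable_EFinP; case/integrableP: iphi.
have [M0 [M00 fM0]] : exists M0, 0 <= M0 /\ {ae mu, forall x, D x -> `|f x| <= M0}.
  exists `|M|; split => //; apply: filterS fM => x + Dx => /(_ Dx) /le_trans.
  by apply; exact: ler_norm.
apply/integrableP; split; first by apply/measurable_EFinP; exact: measurable_funM.
have : mu.-integrable D (fun x => (M0%:E * `|(phi x)%:E|)%E).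
  exact/integrableZl/integrable_abse.
move=> /integrableP[mg]; apply: le_lt_trans.
apply: ae_ge0_le_integral => //.
- by apply: measurableT_comp => //; apply/measurable_EFinP; exact: measurable_funM.
- by apply: measurableT_comp.
- apply: filterS fM0 => x + Dx => /(_ Dx) fxM.
  rewrite abseM abse_id /= -EFinM lee_fin normrM (ger0_norm M00).
  exact: ler_wpM2r.
Qed.

Lemma Rintegral_ae_le f g : mu.-integrable D (EFin \o f) ->
  mu.-integrable D (EFin \o g) -> {ae mu, forall x, D x -> f x <= g x} ->
  \int[mu]_(x in D) f x <= \int[mu]_(x in D) g x.
Proof.
move=> fi gi [N [mN N0 fgN]]; rewrite /Rintegral.
rewrite (negligible_integral mN mD fi N0) (negligible_integral mN mD gi N0).
have mDN := measurableD mD mN.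
apply: le_Rintegral => //; try by apply: integrableS mD mDN (@subDsetl _ _ _) _.
move=> x [Dx Nx]; rewrite leNgt; apply/negP => gf; apply: Nx; apply: fgN => /=.
by move=> /(_ Dx); rewrite leNgt gf.
Qed.

Lemma integrable_indicD B : measurable B -> mu.-integrable D (EFin \o \1_B).
Proof.
move=> mB; apply: measurable_bounded_integrable => //.
exists 1; split => // x x1 y _ /=; rewrite indicE.
by rewrite (le_trans _ (ltW x1))//; case: (_ \in _); rewrite ?normr1 ?normr0.
Qed.

Lemma Rintegral_cst_indicI B (c : R) : measurable B ->
  \int[mu]_(x in D) (c * \1_B x) = c * fine (mu (D `&` B)).
Proof.
move=> mB; rewrite RintegralZl//; last exact: integrable_indicD.
by rewrite /Rintegral integral_indic// setIC.
Qed.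

Lemma Rintegral_cst_indic B (c : R) : measurable B -> B `<=` D ->
  \int[mu]_(x in D) (c * \1_B x) = c * fine (mu B).
Proof. by move=> mB BD; rewrite Rintegral_cst_indicI// setIidr. Qed.

Lemma Linfty_cst (c : R) : Linfty mu D (fun=> c).
Proof.
apply/Linfty_boundedP; split; first exact: measurable_cst.
by exists `|c|; apply: nearW.
Qed.

Section limit_bounds.
Variables (v : nat -> T -> R) (u : T -> R).
Hypotheses (vL : forall j, Linfty mu D (v j)) (uL : Linfty mu D u).
Hypothesis vu : weak_star_cvg mu D v u.

(** An essential value of a weak* limit is, up to [e], between any essential
    bounds of a late term of the sequence: compare the integrals over the set where
    [u] is within [e / 2] of [x]. *)
Lemma weak_star_ess_value (x e : R) : ess_value mu D u x -> 0 < e ->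
  \forall j \near \oo, forall a b,
    {ae mu, forall t, D t -> a <= v j t <= b} -> a <= x + e /\ x - e <= b.
Proof.
move=> ux e0; have e20 : 0 < e / 2 by lra.
have meas_u : measurable_fun D u by case: uL.
set B := D `&` [set t | `|u t - x| < e / 2].
have mB : measurable B by exact: measurable_dist_lt.
have BD : B `<=` D by move=> t [].
have Bfin : mu B \is a fin_num.
  rewrite ge0_fin_numE ?measure_ge0//; apply: le_lt_trans Dfin.
  by apply: le_measure; rewrite ?inE.
pose m := fine (mu B).
have m0 : 0 < m by rewrite fine_gt0// (ux _ e20)/= -ge0_fin_numE.
have iB := integrable_indicD mB.
have iM f : Linfty mu D f -> mu.-integrable D (EFin \o (fun t => f t * \1_B t)).
  by move=> fL; exact: integrable_LinftyM.
have icst c := iM _ (Linfty_cst c).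
have u1 : \int[mu]_(t in D) (u t * \1_B t) <= (x + e / 2) * m.
  rewrite -Rintegral_cst_indic//; apply: le_Rintegral => //; first exact: iM.
  move=> t Dt; rewrite indicE; case: (boolP (t \in B)); rewrite ?mulr0// !mulr1.
  by rewrite inE => -[_ /=]; rewrite ltr_distl => /andP[_ /ltW].
have u2 : (x - e / 2) * m <= \int[mu]_(t in D) (u t * \1_B t).
  rewrite -Rintegral_cst_indic//; apply: le_Rintegral => //; first exact: iM.
  move=> t Dt; rewrite indicE; case: (boolP (t \in B)); rewrite ?mulr0// !mulr1.
  by rewrite inE => -[_ /=]; rewrite ltr_distl => /andP[/ltW].
have em : 0 < e / 2 * m by rewrite mulr_gt0.
have := vu iB => /cvgrPdist_lt /(_ _ em); apply: filterS => j.
rewrite ltr_distlC => /andP[h1 h2] a b vab.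
have v1 : a * m <= \int[mu]_(t in D) (v j t * \1_B t).
  rewrite -Rintegral_cst_indic//; apply: Rintegral_ae_le => //; first exact: iM.
  apply: filterS vab => t + Dt => /(_ Dt) /andP[at_ _].
  by rewrite ler_wpM2r// indicE.
have v2 : \int[mu]_(t in D) (v j t * \1_B t) <= b * m.
  rewrite -Rintegral_cst_indic//; apply: Rintegral_ae_le => //; first exact: iM.
  apply: filterS vab => t + Dt => /(_ Dt) /andP[_ tb].
  by rewrite ler_wpM2r// indicE.
by split; rewrite -(ler_pM2r m0); lra.
Qed.

End limit_bounds.

Lemma limn_einf_lt_frequently (x : nat -> \bar R) (y : \bar R) (N : nat) :
  (limn_einf x < y)%E -> exists2 j, (N <= j)%N & (x j < y)%E.
Proof.
move=> xy; apply: contrapT => nex; move: xy; apply/negP; rewrite -leNgt.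
rewrite limn_einf_lim; apply: lime_ge; first exact: is_cvg_einfs.
exists N => // k /= Nk; apply: le_ereal_inf_tmp => _ [j /= kj <-].
by rewrite leNgt; apply/negP => xjy; apply: nex; exists j => //; exact: leq_trans kj.
Qed.

(** Lower bound for the energy along weak* convergent sequences. *)
Lemma limn_einf_supremal_ge (W : R * R -> R) v u al be :
  (0 < mu D)%E ->
  lower_semicontinuous (EFin \o W) -> coercive W ->
  (forall j, Linfty mu D (v j)) -> Linfty mu D u -> weak_star_cvg mu D v u ->
  ess_value mu D u al -> ess_value mu D u be -> al <= be ->
  (square_envelope (diag_sym W) (al, be) <=
   limn_einf (fun j => supremal mu D (EFin \o W) (v j)))%E.
Proof.
move=> D0 lW cW vL uL vu ual ube alb; apply: ereal_le_realP => c Hc.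
have [e e0|q [qa qb qc]] := @diag_sym_attained _ W al be c lW cW; last first.
  apply/square_envelope_leP => //; exists q => //.
  by split => //=; [exact: le_trans qa alb|exact: le_trans alb qb].
have : (limn_einf (fun j => supremal mu D (EFin \o W) (v j)) < (c + e)%:E)%E.
  by apply: (le_lt_trans Hc); rewrite lte_fin ltrDl.
have [N _ NP] : \forall j \near \oo, forall a b,
    {ae mu, forall t, D t -> a <= v j t <= b} -> a <= al + e /\ be - e <= b.
  move: (weak_star_ess_value vL uL vu ual e0) (weak_star_ess_value vL uL vu ube e0).
  by apply: filterS2 => j h1 h2 a b vab; split; [have [] := h1 _ _ vab|have [] := h2 _ _ vab].
move=> /(limn_einf_lt_frequently N)[j Nj /ltW Jc].
have [a av va] := ess_min_exists mD D0 (vL j).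
have [b bv vb] := ess_max_exists mD D0 (vL j).
have [|aal bbe] := NP j Nj a b.
  by move: av bv; apply: filterS2 => t h1 h2 Dt; rewrite h1 ?h2.
exists (a, b); split => //.
by apply: supremal_diag_sym_le Jc va vb => //; case: (vL j).
Qed.

End weak_star_bounds.

(** * Two-valued weak* approximation *)

Section oscillation.
Context d (T : measurableType d) (R : realType).
Variables (mu : {sigma_finite_measure set T -> \bar R}) (D : set T).
Hypotheses (mD : measurable D) (Dfin : (mu D < +oo)%E).
Implicit Types (u phi psi : T -> R).

Section null_sequences.
Variables (w : nat -> T -> R) (M : R).
Hypothesis wL : forall j, Linfty mu D (w j).
Hypothesis wM : forall j, {ae mu, forall x, D x -> `|w j x| <= M}.

(** [phi] is an integrable test function whose pairing with [w j] tends to 0. *)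
Definition null_test phi := mu.-integrable D (EFin \o phi) /\
  \int[mu]_(x in D) (w j x * phi x) @[j --> \oo] --> (0 : R).

Let iw j phi : mu.-integrable D (EFin \o phi) ->
  mu.-integrable D (EFin \o (fun x => w j x * phi x)).
Proof. exact: integrable_LinftyM. Qed.

Lemma null_testD phi psi : null_test phi -> null_test psi ->
  null_test (fun x => phi x + psi x).
Proof.
move=> [ip hp] [iq hq]; split.
  by have := integrableD mD ip iq; apply: eq_integrable => // x _ /=; rewrite EFinD.
rewrite [X in X @ _](_ : _ = (fun j => \int[mu]_(x in D) (w j x * phi x) +
    \int[mu]_(x in D) (w j x * psi x))).
  by rewrite -(addr0 (0 : R)); exact: cvgD.
apply/funext => j; rewrite -RintegralD//; [|exact: iw..].
by apply: eq_Rintegral => x _; rewrite mulrDr.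
Qed.

Lemma null_testZ (k : R) phi : null_test phi -> null_test (fun x => k * phi x).
Proof.
move=> [ip hp]; split.
  by have := integrableZl mD k ip; apply: eq_integrable => // x _ /=; rewrite EFinM.
rewrite [X in X @ _](_ : _ = (fun j => k * \int[mu]_(x in D) (w j x * phi x))).
  by rewrite -(mulr0 k); apply: cvgM => //; exact: cvg_cst.
apply/funext => j; rewrite -RintegralZl//; last exact: iw.
by apply: eq_Rintegral => x _; rewrite mulrCA.
Qed.

Lemma null_test0 : null_test (fun=> 0).
Proof.
split; first by have := integrable0 mu D; apply: eq_integrable.
rewrite (_ : (fun _ => _) = (fun=> 0)); first exact: cvg_cst.
apply/funext => j; rewrite (@eq_Rintegral _ _ _ _ _ (fun=> 0)) ?Rintegral_cst ?mul0r//.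
by move=> x _; rewrite mulr0.
Qed.

Lemma null_test_sum (I : Type) (s : seq I) (phi : I -> T -> R) :
  (forall i, null_test (phi i)) -> null_test (fun x => \sum_(i <- s) phi i x).
Proof.
move=> H; elim: s => [|i s IH].
  by under eq_fun do rewrite big_nil; exact: null_test0.
by under eq_fun do rewrite big_cons; exact: null_testD.
Qed.

(** Null tests form a closed subset of L^1, because [w] is bounded. *)
Lemma null_test_closed phi : mu.-integrable D (EFin \o phi) ->
  (forall e, 0 < e -> exists2 psi, null_test psi &
     \int[mu]_(x in D) `|phi x - psi x| <= e) -> null_test phi.
Proof.
move=> ip H; split=> //; apply/cvgr0Pnorm_le => e e0.
have M1 : 0 < `|M| + 1 by rewrite ltr_wpDl.
have [|psi [iq hq] hpsi] := H (e / 2 / (`|M| + 1)); first by rewrite !divr_gt0.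
have e20 : 0 < e / 2 by lra.
move/cvgr0Pnorm_le : hq => /(_ _ e20); apply: filterS => j hj.
have ipq : mu.-integrable D (EFin \o (fun x => phi x - psi x)).
  by have := integrableB mD ip iq; apply: eq_integrable => // x _ /=; rewrite EFinB.
have -> : \int[mu]_(x in D) (w j x * phi x) =
    \int[mu]_(x in D) (w j x * psi x) +
    \int[mu]_(x in D) (w j x * (phi x - psi x)).
  rewrite -RintegralD//; [|exact: iw..].
  by apply: eq_Rintegral => x _; rewrite -mulrDr addrC subrK.
rewrite [leRHS]splitr (le_trans (ler_normD _ _))// lerD//.
rewrite (le_trans (le_normr_Rintegral mD (iw j ipq)))//.
have inpq : mu.-integrable D (EFin \o (fun x => `|phi x - psi x|)).
  exact: (integrable_abse ipq).
apply: (@le_trans _ _ (\int[mu]_(x in D) ((`|M| + 1) * `|phi x - psi x|))).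
  apply: Rintegral_ae_le => //.
  - exact: (integrable_abse (iw j ipq)).
  - exact: (integrableZl mD (`|M| + 1) inpq).
  apply: filterS (wM j) => x + Dx => /(_ Dx) wx; rewrite normrM ler_wpM2r//.
  by rewrite (le_trans wx)// (le_trans (ler_norm _))// lerDl.
by rewrite RintegralZl// mulrC -ler_pdivlMr.
Qed.

Let mI (A : set T) : measurable A -> mu.-integrable D (EFin \o \1_A).
Proof. exact: integrable_indicD. Qed.

(** If the indicators of a generating pi-system are null tests, then so are all
    integrable functions. *)
Lemma null_test_integrable (G : set (set T)) :
  @measurable _ T = <<s G >> -> setI_closed G ->
  null_test (fun=> 1) -> (forall A, G A -> null_test \1_A) ->
  forall phi, mu.-integrable D (EFin \o phi) -> null_test phi.
Proof.
move=> GE GI n1 nG.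
have nI A : measurable A -> null_test \1_A.
  rewrite GE; move: A; apply: (dynkin_induction GE GI) => //.
  - by rewrite indicT; exact: n1.
  - move=> S mS nS; have := null_testD n1 (null_testZ (-1) nS).
    congr null_test; apply/funext => x; rewrite !indicE in_setC.
    by case: (x \in S); rewrite /= ?mulr1 ?mulr0 ?subrr ?addr0.
  - move=> F mF tF nF; have mUF : measurable (\bigcup_k F k) by exact: bigcup_measurable.
    (* The indicator of the union is the L^1 limit of the finite sums, the error
       after [n] terms being the indicator of [U n]. *)
    apply: null_test_closed; first exact: mI.
    move=> e e0; pose U n := D `&` \bigcup_(k in [set k | (n <= k)%N]) F k.
    have mU n : measurable (U n) by apply: measurableI => //; exact: bigcup_measurable.
    have UfinD n : (mu (U n) < +oo)%E.
      by apply: le_lt_trans Dfin; apply: le_measure; rewrite ?inE// => x [].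
    have Ufin n : mu (U n) \is a fin_num by rewrite ge0_fin_numE.
    have U0 : mu (U n) @[n --> \oo] --> mu (\bigcap_n U n).
      apply: nonincreasing_cvg_mu => //.
      + exact: UfinD.
      + exact: bigcapT_measurable.
      + move=> m n mn; apply/subsetPset => x [Dx [k /= nk Fk]]; split => //.
        by exists k => //=; exact: leq_trans nk.
    have capU : \bigcap_n U n = set0.
      apply/seteqP; split => // x xU.
      have [_ [k _ Fk]] := xU 0%N I.
      have [_ [k' /= kk' Fk']] := xU k.+1 I.
      have : k = k' by apply: tF => //; exists x.
      by move=> kE; move: kk'; rewrite kE ltnn.
    rewrite capU measure0 in U0.
    move/fine_cvgP : U0 => [_ /cvgr0Pnorm_le /(_ _ e0)[N _ NP]].
    exists (fun x => \sum_(k <- index_iota 0 N) \1_(F k) x); first exact: null_test_sum.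
    apply: le_trans (NP N (leqnn N)).
    apply: le_trans (ler_norm _).
    have UD : U N `<=` D by move=> x [].
    rewrite /= -[leRHS]mul1r -(Rintegral_cst_indic mD Dfin 1 (mU N) UD).
    rewrite le_eqVlt; apply/orP; left; apply/eqP.
    apply: eq_Rintegral => x; rewrite inE => Dx; rewrite mul1r.
    have F0 k0 k : F k0 x -> k != k0 -> \1_(F k) x = 0 :> R.
      move=> Fk0 kk0; rewrite indicE memNset// => Fk.
      by move/eqP: kk0; apply; apply: tF => //; exists x.
    have [[k0 _ Fk0]|nF'] := pselect ((\bigcup_k F k) x); last first.
      rewrite [\1_(\bigcup_k F k) x]indicE memNset// big1 ?subrr ?normr0.
        rewrite indicE memNset// => -[_ [k _ Fk]]; by apply: nF'; exists k.
      by move=> k _; rewrite indicE memNset// => Fk; apply: nF'; exists k.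
    rewrite [\1_(\bigcup_k F k) x]indicE mem_set; last by exists k0.
    have [k0N|Nk0] := ltnP k0 N.
      rewrite (bigD1_seq k0)/= ?iota_uniq ?mem_index_iota// big1 => [|k]; last exact: F0.
      rewrite [\1_(F k0) x]indicE mem_set// addr0 subrr normr0.
      rewrite indicE memNset// => -[_ [k /= Nk Fk]].
      have kk0 : k = k0 by apply: tF => //; exists x.
      by move: Nk; rewrite kk0 leqNgt k0N.
    rewrite big_seq big1 ?subr0 ?normr1 => [|k]; last first.
      rewrite mem_index_iota => /andP[_ kN]; apply: (F0 k0) => //.
      by apply: contraTneq kN => ->; rewrite -leqNgt.
    by rewrite indicE mem_set//; split => //; exists k0.
move=> phi iphi; apply: null_test_closed => // e e0.
have [g [ig _ gphi]] := approximation_sfun_integrable mD iphi.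
move/fine_cvgP : gphi => [_ /cvgr0Pnorm_le /(_ _ e0)[N _ NP]].
exists (g N).
  rewrite (funext (fimfunEord (g N)) : (g N : T -> R) = _).
  by apply: null_test_sum => y; apply/null_testZ/nI.
apply: le_trans (NP N (leqnn N)).
by apply: le_trans (ler_norm _).
Qed.

End null_sequences.

Lemma Rintegral_sum (I : Type) (s : seq I) (h : I -> T -> R) :
  (forall i, mu.-integrable D (EFin \o h i)) ->
  \int[mu]_(x in D) (\sum_(i <- s) h i x) = \sum_(i <- s) \int[mu]_(x in D) h i x.
Proof.
move=> ih; suff : mu.-integrable D (EFin \o (fun x => \sum_(i <- s) h i x)) /\
    \int[mu]_(x in D) (\sum_(i <- s) h i x) = \sum_(i <- s) \int[mu]_(x in D) h i x.
  by case.
elim: s => [|i s [IH1 IH2]].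
  rewrite big_nil (_ : (fun x => _) = fun=> 0); last first.
    by apply/funext => x; rewrite big_nil.
  by split; [exact: integrable0|rewrite Rintegral_cst// mul0r].
rewrite big_cons (_ : (fun x => _) = fun x => h i x + \sum_(j <- s) h j x); last first.
  by apply/funext => x; rewrite big_cons.
split; last by rewrite RintegralD// IH2.
by have := integrableD mD (ih i) IH1; apply: eq_integrable => // x _ /=; rewrite EFinD.
Qed.

Section slicing.
Variables (f : T -> R) (l r K : R).
Hypotheses (mf : measurable_fun setT f) (lr : l <= r).
Hypothesis flr : forall x, D x -> l <= f x < r.
(* The law of [f] on [D] is dominated by [K] times the Lebesgue measure. *)
Hypothesis fK : forall s t, s <= t ->
  (mu (D `&` [set x | (s <= f x < t)%R]) <= (K * (t - s))%:E)%E.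

Lemma measurable_sublevel t : measurable [set x | f x < t].
Proof.
have := mf measurableT (measurable_itv `]-oo, t[); rewrite setTI.
by congr measurable; apply/seteqP; split => x /=; rewrite in_itv.
Qed.

(** The sublevel sets of [f] cut the part in [D] of a measurable set in any
    prescribed proportion. *)
Lemma slice_measure (C : set T) (y : R) : measurable C ->
  0 <= y <= fine (mu (D `&` C)) ->
  exists t, fine (mu (D `&` (C `&` [set x | f x < t]))) = y.
Proof.
move=> mC y01.
pose S t := D `&` (C `&` [set x | f x < t]).
pose m t := fine (mu (S t)).
have mS t : measurable (S t).
  by apply: measurableI => //; apply: measurableI => //; exact: measurable_sublevel.
have finD A : measurable A -> A `<=` D -> mu A \is a fin_num.
  move=> mA AD; rewrite ge0_fin_numE//; apply: le_lt_trans Dfin.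
  by apply: le_measure; rewrite ?inE.
have Sfin t : mu (S t) \is a fin_num by apply: finD => // x [].
have m_mono s t : s <= t -> m s <= m t.
  move=> st; apply: fine_le => //; apply: le_measure; rewrite ?inE//.
  by move=> x [Dx [Cx /= fs]]; split => //; split => //=; exact: lt_le_trans st.
have mslab s t : measurable (D `&` [set x | s <= f x < t]).
  apply: measurableI => //.
  have := mf measurableT (measurable_itv `[s, t[); rewrite setTI.
  by congr measurable; apply/seteqP; split => x /=; rewrite in_itv.
have m_lip s t : s <= t -> m t <= m s + K * (t - s).
  move=> st; rewrite -lee_fin EFinD !fineK//.
  apply: le_trans (leeD2l _ (fK st)).
  apply: le_trans (measureU2 _ (mS s) (mslab s t)).
  apply: le_measure; rewrite ?inE//; first exact: measurableU.
  move=> x [Dx [Cx /= ft]]; have [sf|fs] := leP s (f x); last by left.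
  by right; split => //=; rewrite sf.
have m_dist s t : `|m s - m t| <= (`|K| + 1) * `|s - t|.
  wlog st : s t / s <= t => [H|].
    have [st|/ltW ts] := leP s t; first exact: H.
    by rewrite distrC (distrC s); exact: H.
  rewrite distrC (distrC s) (@ger0_norm _ (m t - m s)) ?subr_ge0 ?m_mono//.
  rewrite (@ger0_norm _ (t - s)) ?subr_ge0//.
  rewrite lerBlDl (le_trans (m_lip s t st))// lerD2l ler_wpM2r ?subr_ge0//.
  by rewrite (le_trans (ler_norm _))// lerDl.
have K1 : 0 < `|K| + 1 by rewrite ltr_wpDl.
have cm : continuous m.
  move=> s; apply/cvgrPdist_le => e e0.
  exists (e / (`|K| + 1)); first by rewrite /= divr_gt0.
  move=> t /= /ltW; rewrite ler_pdivlMr// mulrC => st.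
  exact: le_trans (m_dist s t) st.
have ml : m l = 0.
  rewrite /m (_ : S l = set0) ?measure0//; apply/seteqP; split => // x [Dx [_ /=]].
  by have /andP[lf _] := flr Dx; rewrite ltNge lf.
have mr : m r = fine (mu (D `&` C)).
  rewrite /m (_ : S r = D `&` C)//; apply/seteqP; split => [x [Dx [Cx _]]|x [Dx Cx]] //.
  by split => //; split => //=; have /andP[] := flr Dx.
have [|t _ mt] := @IVT R m l r y lr (continuous_subspaceT cm).
  by case/andP: y01 => y0 y1; rewrite ml mr ge_min le_max y0 y1 orbT.
by exists t.
Qed.

Section two_valued.
Variables (u : T -> R) (a b : R) (B : nat -> set T).
Hypotheses (mB : forall i, measurable (B i)).
Hypothesis gB : @measurable _ T = <<s range B >>.
Hypotheses (meas_u : measurable_fun D u).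
Hypothesis uab : {ae mu, forall x, D x -> a <= u x <= b}.

Let uL : Linfty mu D u.
Proof.
apply/Linfty_boundedP; split => //; exists (`|a| + `|b|).
apply: filterS uab => x + Dx => /(_ Dx) /andP[au ub].
have := ler_norm b; have := ler_norm (- a); rewrite normrN => ha hb.
rewrite ler_norml; have := normr_ge0 a; have := normr_ge0 b; lra.
Qed.

(** The two-valued function equal to [b] where [f] is below [t]. *)
Let threshold t x := if f x < t then b else a.

Let thresholdE (C : set T) t x : threshold t x * \1_C x =
  a * \1_C x + (b - a) * \1_(C `&` [set x | f x < t]) x.
Proof.
rewrite /threshold !indicE in_setI; case: (boolP (x \in C)) => _; last first.
  by rewrite !mulr0 addr0.
have -> : (x \in [set x | f x < t]) = (f x < t).
  by apply/idP/idP => [|h]; rewrite inE.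
by case: (f x < t) => /=; lra.
Qed.

(** A threshold for which the two-valued function has the same integral over [C]
    as [u]. *)
Lemma threshold_exists (C : set T) : measurable C -> exists t,
  \int[mu]_(x in D) (threshold t x * \1_C x) = \int[mu]_(x in D) (u x * \1_C x).
Proof.
move=> mC.
have iI A : measurable A -> mu.-integrable D (EFin \o \1_A) by exact: integrable_indicD.
have icI (c : R) A : measurable A -> mu.-integrable D (EFin \o (fun x => c * \1_A x)).
  by move=> mA; exact: integrableZl (iI _ mA).
have iu : mu.-integrable D (EFin \o (fun x => u x * \1_C x)).
  exact/integrable_LinftyM/iI.
have thE t : \int[mu]_(x in D) (threshold t x * \1_C x) =
    a * fine (mu (D `&` C)) + (b - a) * fine (mu (D `&` (C `&` [set x | f x < t]))).
  have mCt : measurable (C `&` [set x | f x < t]).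
    by apply: measurableI => //; exact: measurable_sublevel.
  rewrite -!Rintegral_cst_indicI// -RintegralD//; [|exact: icI..].
  by apply: eq_Rintegral => x _; exact: thresholdE.
set U := \int[mu]_(x in D) (u x * \1_C x).
have aU : a * fine (mu (D `&` C)) <= U.
  rewrite -Rintegral_cst_indicI//; apply: Rintegral_ae_le => //; first exact: icI.
  by apply: filterS uab => x + Dx => /(_ Dx) /andP[? _]; rewrite ler_wpM2r// indicE.
have Ub : U <= b * fine (mu (D `&` C)).
  rewrite -Rintegral_cst_indicI//; apply: Rintegral_ae_le => //; first exact: icI.
  by apply: filterS uab => x + Dx => /(_ Dx) /andP[_ ?]; rewrite ler_wpM2r// indicE.
(* If [b <= a], then [a = b] or [C] is negligible in [D], and any threshold
   works. *)
have [ab|ba] := ltP a b; last first.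
  have [D0|nD0] := eqVneq (fine (mu (D `&` C))) 0.
    exists l; rewrite thE D0.
    have -> : fine (mu (D `&` (C `&` [set x | f x < l]))) = 0.
      rewrite (_ : _ `&` _ = set0) ?measure0//; apply/seteqP; split => // x [Dx [_ /=]].
      by have /andP[lf _] := flr Dx; rewrite ltNge lf.
    by move: aU Ub; rewrite D0 !mulr0 addr0 => h1 h2; apply/eqP; rewrite eq_le h1 h2.
  have m0 : 0 < fine (mu (D `&` C)) by rewrite lt0r nD0 fine_ge0.
  have abE : a = b.
    apply/eqP; rewrite eq_le ba andbT -(ler_pM2r m0).
    exact: le_trans aU Ub.
  exists l; rewrite thE abE subrr mul0r addr0; apply/eqP; rewrite eq_le Ub andbT.
  by rewrite -{1}abE.
have ba0 : 0 < b - a by rewrite subr_gt0.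
have [|t tE] := @slice_measure C ((U - a * fine (mu (D `&` C))) / (b - a)) mC.
  apply/andP; split; first by rewrite divr_ge0 ?subr_ge0// ltW.
  by rewrite ler_pdivrMr//; lra.
exists t; rewrite thE tE; field; exact: lt0r_neq0.
Qed.

(** [code j x] records which of the sets [B 0], ..., [B (j - 1)] contain [x]; its
    fibres, the sets [cell j c], form the partition of level [j]. *)
Let code j x : {ffun 'I_j -> bool} := [ffun i : 'I_j => x \in B i].
Let cell j (c : {ffun 'I_j -> bool}) : set T := [set x | code j x = c].
Arguments cell : clear implicits.

Let mcell j c : measurable (cell j c).
Proof.
rewrite (_ : cell j c = \bigcap_(i in [set: 'I_j]) (if c i then B i else ~` B i)).
  by apply: fin_bigcap_measurable => // i _; case: (c i) => //; exact: measurableC.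
apply/seteqP; split => [x /= <- i _|x /= H].
  by rewrite ffunE; case: ifPn => [|/negP]; rewrite inE.
apply/ffunP => i; rewrite ffunE; have := H i I.
by case: (c i) => h; [rewrite mem_set|rewrite memNset].
Qed.

Let code_sum j (F : {ffun 'I_j -> bool} -> R) x :
  F (code j x) = \sum_c F c * \1_(cell j c) x.
Proof.
rewrite (bigD1 (code j x))//= indicE mem_set// mulr1 big1 ?addr0// => c cx.
by rewrite indicE memNset ?mulr0// => /= xc; move: cx; rewrite xc eqxx.
Qed.

(** [A] is a union of cells of level [j]. *)
Let depends j (A : set T) := forall x y, code j x = code j y -> A x -> A y.

Let dependsS j k A : (j <= k)%N -> depends j A -> depends k A.
Proof.
move=> jk dA x y xy; apply: dA; apply/ffunP => i.
by move/ffunP: xy => /(_ (widen_ord jk i)); rewrite !ffunE.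
Qed.

Let depends_sum j A : depends j A -> exists F : {ffun 'I_j -> bool} -> R,
  forall x, \1_A x = \sum_c F c * \1_(cell j c) x.
Proof.
move=> dA; exists (fun c => if `[< exists2 y, A y & code j y = c >] then 1 else 0).
move=> x; rewrite -code_sum indicE; case: asboolP => [[y Ay yx]|nA].
  by rewrite mem_set//; exact: dA yx Ay.
by rewrite memNset// => Ax; apply: nA; exists x.
Qed.

Let depends_measurable j A : depends j A -> measurable A.
Proof.
move=> /depends_sum[F FE]; apply/(@measurable_indicP _ _ R).
rewrite (funext FE); apply: measurable_sum => c.
by apply: measurable_funM => //; exact: measurable_indic.
Qed.

(** Every measurable function with values in [a, b] is a weak* limit of functions
    with values in {a, b}. *)
Lemma two_valued_approximation : exists v : nat -> T -> R,
  [/\ forall j, Linfty mu D (v j), forall j x, v j x = a \/ v j x = b &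
      weak_star_cvg mu D v u].
Proof.
have /choice[g gP] := fun p : {j : nat & {ffun 'I_j -> bool}} =>
  threshold_exists (mcell (tagged p)).
pose th j (c : {ffun 'I_j -> bool}) : R := g (Tagged (fun j => {ffun 'I_j -> bool}) c).
have thE j c : \int[mu]_(x in D) (threshold (th j c) x * \1_(cell j c) x) =
    \int[mu]_(x in D) (u x * \1_(cell j c) x).
  exact: (gP (Tagged (fun j => {ffun 'I_j -> bool}) c)).
pose v j x := threshold (th j (code j x)) x.
have mv j : measurable_fun setT (v j).
  apply: measurable_fun_ifT => //; apply: measurable_fun_ltr => //.
  rewrite (funext (code_sum (th j))); apply: measurable_sum => c.
  by apply: measurable_funM => //; exact: measurable_indic.
have vab j x : v j x = a \/ v j x = b by rewrite /v /threshold; case: ifP; [right|left].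
have vL j : Linfty mu D (v j).
  apply/Linfty_boundedP; split; first exact: measurable_funTS.
  exists (`|a| + `|b|); apply: nearW => x _.
  by case: (vab j x) => ->; rewrite ?lerDl ?lerDr.
exists v; split => //.
pose w j x := v j x - u x.
have wM j : {ae mu, forall x, D x -> `|w j x| <= `|b - a|}.
  apply: filterS uab => x + Dx => /(_ Dx) /andP[au ub].
  rewrite (@ger0_norm _ (b - a)) ?subr_ge0 ?(le_trans au ub)// ler_norml /w.
  by case: (vab j x) => ->; lra.
have wL j : Linfty mu D (w j).
  apply/Linfty_boundedP; split; last by exists `|b - a|; exact: wM.
  by apply: measurable_funB => //; exact: measurable_funTS.
have iI A : measurable A -> mu.-integrable D (EFin \o \1_A) by exact: integrable_indicD.
have w0 j (c : {ffun 'I_j -> bool}) : \int[mu]_(x in D) (w j x * \1_(cell j c) x) = 0.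
  apply/eqP; have /eqP := thE j c; rewrite -subr_eq0 => /eqP <-.
  rewrite (_ : \int[mu]_(x in D) (threshold _ _ * _) =
    \int[mu]_(x in D) (v j x * \1_(cell j c) x)); last first.
    apply: eq_Rintegral => x _; rewrite indicE; case: (boolP (x \in cell j c)).
      by rewrite inE /v => /= ->.
    by rewrite !mulr0.
  rewrite -RintegralB//; [|exact/integrable_LinftyM/iI..].
  by apply/eqP; apply: eq_Rintegral => x _; rewrite mulrBl.
(* The sets that depend on finitely many of the [B i] form a pi-system, which
   contains each [B i]. *)
pose G := [set A | exists j, depends j A].
have nG A : G A -> null_test w \1_A.
  move=> [j dA]; split; first exact/iI/depends_measurable/dA.
  apply: cvg_near_cst; exists j => // k /= jk.
  have [F FE] := depends_sum (dependsS jk dA).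
  have iwc c : mu.-integrable D (EFin \o (fun x => w k x * \1_(cell k c) x)).
    exact/integrable_LinftyM/iI.
  rewrite (@eq_Rintegral _ _ _ _ _ (fun x => \sum_c F c * (w k x * \1_(cell k c) x))).
    rewrite Rintegral_sum => [|c]; last exact: (integrableZl mD (F c) (iwc c)).
    by rewrite big1// => c _; rewrite RintegralZl ?w0 ?mulr0//; exact: iwc.
  by move=> x _; rewrite FE mulr_sumr; apply: eq_bigr => c _; rewrite mulrCA.
have nall : forall phi, mu.-integrable D (EFin \o phi) -> null_test w phi.
  apply: (null_test_integrable wL wM (G := G)) => //.
  - rewrite gB; apply/seteqP; split.
      apply: smallest_sub; first exact: smallest_sigma_algebra.
      move=> _ [i _ <-]; apply: sub_sigma_algebra; exists i.+1 => x y.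
      move=> /ffunP /(_ ord_max); rewrite !ffunE /= => xy /mem_set.
      by rewrite xy inE.
    rewrite -gB; apply: smallest_sub; first exact: sigma_algebra_measurable.
    by move=> A [j /depends_measurable].
  - move=> A A' [j dA] [j' dA']; exists (maxn j j') => x y xy [Ax A'x]; split.
      by apply: (dependsS (leq_maxl j j') dA) xy Ax.
    by apply: (dependsS (leq_maxr j j') dA') xy A'x.
  - by have := nG setT; rewrite indicT; apply; exists 0%N.
move=> phi iphi; have [_ h] := nall phi iphi.
rewrite [X in X @ _](_ : _ = (fun j => \int[mu]_(x in D) (w j x * phi x) +
    \int[mu]_(x in D) (u x * phi x))).
  by rewrite -[X in _ --> X]add0r; apply: cvgD => //; exact: cvg_cst.
apply/funext => j; rewrite -RintegralD//; [|exact: integrable_LinftyM..].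
by apply: eq_Rintegral => x _; rewrite -mulrDl /w subrK.
Qed.

End two_valued.
End slicing.
End oscillation.

(** * The relaxation formula over an abstract domain *)

Section relaxation_formula.
Context d (T : measurableType d) (R : realType).
Variables (mu : {sigma_finite_measure set T -> \bar R}) (D : set T).
Hypotheses (mD : measurable D) (Dfin : (mu D < +oo)%E) (D0 : (0 < mu D)%E).
Variables (f : T -> R) (l r K : R) (B : nat -> set T).
Hypotheses (mf : measurable_fun setT f) (lr : l <= r).
Hypothesis flr : forall x, D x -> l <= f x < r.
Hypothesis fK : forall s t, s <= t ->
  (mu (D `&` [set x | (s <= f x < t)%R]) <= (K * (t - s))%:E)%E.
Hypotheses (mB : forall i, measurable (B i)).
Hypothesis gB : @measurable _ T = <<s range B >>.
Variable W : R * R -> R.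
Hypotheses (lW : lower_semicontinuous (EFin \o W)) (cW : coercive W).

Let J := supremal mu D (EFin \o W).
Let Wslc := square_envelope (diag_sym W).

Lemma limn_einf_le (x : nat -> \bar R) (c : \bar R) :
  (forall j, x j <= c)%E -> (limn_einf x <= c)%E.
Proof.
move=> xc; rewrite limn_einf_lim; apply: lime_le; first exact: is_cvg_einfs.
by apply: nearW => n; apply: ge_ereal_inf; exists (x n) => //; exists n => /=.
Qed.

(** On functions with values in {q.1, q.2}, the functional is at most
    [diag_sym W q]. *)
Lemma recovery_sequence (u : T -> R) (q : R * R) : measurable_fun D u ->
  {ae mu, forall x, D x -> q.1 <= u x <= q.2} ->
  exists v : nat -> T -> R, [/\ forall j, Linfty mu D (v j),
    weak_star_cvg mu D v u & forall j, (J (v j) <= (diag_sym W q)%:E)%E].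
Proof.
move=> meas_u uq.
have [v [vL vq vu]] := two_valued_approximation mD Dfin mf lr flr fK mB gB meas_u uq.
exists v; split => // j; apply/supremal_leP; apply: nearW => p _ _ /=.
have /diag_sym_le[q1 q2 q3 q4] := lexx (diag_sym W q).
rewrite lee_fin; case: (vq j p.1) => ->; case: (vq j p.2) => -> //.
by rewrite -surjective_pairing.
Qed.

Lemma relaxation_supremal (u : T -> R) : Linfty mu D u ->
  relaxation mu D J u = supremal mu D Wslc u.
Proof.
move=> uL; have meas_u : measurable_fun D u by case: uL.
have [al alu eal] := ess_min_exists mD D0 uL.
have [be ube ebe] := ess_max_exists mD D0 uL.
have uab : {ae mu, forall x, D x -> al <= u x <= be}.
  by move: alu ube; apply: filterS2 => x h1 h2 Dx; rewrite h1 ?h2.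
rewrite (supremal_square_envelope mD lW cW meas_u uab eal ebe).
apply/eqP; rewrite eq_le; apply/andP; split.
  apply: ereal_le_realP => c /square_envelope_leP[//|//|q [q1 q2 q3 q4] qc].
  have [|v [vL vu vJ]] := @recovery_sequence u q meas_u.
    apply: filterS uab => x + Dx => /(_ Dx) /andP[au ub].
    by rewrite (le_trans q1 au) (le_trans ub q4).
  apply: ge_ereal_inf; exists (limn_einf (fun j => J (v j))); first by exists v.
  by apply: limn_einf_le => j; apply: le_trans (vJ j) _; rewrite lee_fin.
apply: le_ereal_inf_tmp => _ [v [vL vu] <-].
apply: (limn_einf_supremal_ge mD Dfin D0 lW cW vL uL vu eal ebe).
have [x xP] : exists x, al <= u x <= be.
  apply: contrapT => /forallNP nex; move: D0; rewrite (@ae_not_gt0 _ _ _ mu D) ?ltxx//.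
  by apply: filterS uab => x ux Dx; apply: (nex x); exact: ux.
by case/andP: xP; exact: le_trans.
Qed.

(** A function taking the two values [x] and [y], each on half of [D]. *)
Lemma two_valued_ess_value (x y : R) : exists u : T -> R,
  [/\ Linfty mu D u, forall t, u t = x \/ u t = y,
      ess_value mu D u x & ess_value mu D u y].
Proof.
have muD0 : 0 < fine (mu D) by rewrite fine_gt0// D0.
have [|t tE] := @slice_measure _ _ _ mu D mD Dfin f l r K mf lr flr fK setT
  (fine (mu D) / 2) measurableT.
  by rewrite setIT; lra.
rewrite setTI in tE.
set S := [set s | f s < t] in tE.
have mS : measurable S := measurable_sublevel mf t.
have mDS : measurable (D `&` S) by exact: measurableI.
have mDSc : measurable (D `\` S) by exact: measurableD.
have finD A : measurable A -> A `<=` D -> mu A \is a fin_num.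
  move=> mA AD; rewrite ge0_fin_numE//; apply: le_lt_trans Dfin.
  by apply: le_measure; rewrite ?inE.
have hS : (0 < mu (D `&` S))%E.
  rewrite -[X in (0 < X)%E]fineK; last by apply: finD => // s [].
  by rewrite tE lte_fin divr_gt0.
have hSc : (0 < mu (D `\` S))%E.
  rewrite -[X in (0 < X)%E]fineK; last by apply: finD => // s [].
  have := measureDI mu mD mS => /(congr1 fine); rewrite fineD ?tE; last 2 first.
  - by apply: finD => // s [].
  - by apply: finD => // s [].
  by rewrite lte_fin; lra.
pose u s := if f s < t then x else y.
have meas_u : measurable_fun D u.
  by apply: measurable_funTS; apply: measurable_fun_ifT => //; apply: measurable_fun_ltr.
have uxy s : u s = x \/ u s = y by rewrite /u; case: ifP; [left|right].
exists u; split => //.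
- apply/Linfty_boundedP; split => //; exists (`|x| + `|y|); apply: nearW => s _.
  by case: (uxy s) => ->; rewrite ?lerDl ?lerDr.
- move=> e e0; apply: (lt_le_trans hS); apply: le_measure; rewrite ?inE//.
    exact: measurable_dist_lt.
  by move=> s [Ds /= fs]; split => //=; rewrite /u fs subrr normr0.
- move=> e e0; apply: (lt_le_trans hSc); apply: le_measure; rewrite ?inE//.
    exact: measurable_dist_lt.
  by move=> s [Ds /= /negP/negbTE fs]; split => //=; rewrite /u fs subrr normr0.
Qed.

Lemma supremal_diag_sym_ge (u : T -> R) :
  (J u <= supremal mu D (EFin \o diag_sym W) u)%E.
Proof.
apply: ereal_le_realP => c /supremal_leP H; apply/supremal_leP.
apply: filterS H => p H d1 d2; have := H d1 d2.
by rewrite /= !lee_fin => /diag_sym_le[].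
Qed.

Lemma weak_star_lsc_supremal :
  weak_star_lsc mu D J <-> separately_level_convex (EFin \o diag_sym W).
Proof.
have [slcW _ maxW] := square_envelopeP lW cW.
split=> [Jlsc|slc].
  suff -> : EFin \o diag_sym W = Wslc by [].
  apply/funext => p; apply/eqP; rewrite eq_le square_envelope_le andbT.
  (* Approximate a function with essential values [p.1] and [p.2] by functions
     taking their values at the corner of an optimal square around [p]. *)
  apply: ereal_le_realP => c /square_envelope_leP[//|//|q [q1 q2 q3 q4] qc].
  have [u [uL up eu1 eu2]] := two_valued_ess_value p.1 p.2.
  have meas_u : measurable_fun D u by case: uL.
  have [|v [vL vu vJ]] := @recovery_sequence u q meas_u.
    by apply: nearW => s _; case: (up s) => ->; apply/andP; split.
  rewrite /= lee_fin [p]surjective_pairing.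
  apply: (supremal_diag_sym_le mD lW meas_u _ eu1 eu2).
  apply: (le_trans (Jlsc v u vL uL vu)); apply: limn_einf_le => j.
  by apply: le_trans (vJ j) _; rewrite lee_fin.
move=> v u vL uL vu.
have WE : EFin \o diag_sym W = Wslc.
  apply/funext => p; apply/eqP; rewrite eq_le square_envelope_le andbT.
  by apply: maxW.
apply: (le_trans (supremal_diag_sym_ge u)); rewrite WE -relaxation_supremal//.
by apply: ge_ereal_inf; exists (limn_einf (fun j => J (v j))) => //; exists v.
Qed.

End relaxation_formula.

(** * Bounded open sets of the Euclidean space *)

Section euclidean_space.
Context {R : realType} (n : nat).
Notation mu := (lebesgue_rV n.+1 : {sigma_finite_measure set 'rV[R]_n.+1 -> \bar R}).

Lemma ler_mx_coord (m k : nat) (x : 'M[R]_(m, k)) i j : `|x i j| <= `|x|.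
Proof.
rewrite [leRHS]mx_normrE.
exact: (le_bigmax _ (fun p : 'I_m * 'I_k => `|x p.1 p.2|) (i, j)).
Qed.

Lemma measurable_rV_box (a b : 'rV[R]_n.+1) :
  measurable [set v : 'rV[R]_n.+1 | forall i, v ord0 i \in `[a ord0 i, b ord0 i]].
Proof.
rewrite [X in measurable X](_ : _ = \bigcap_(i in [set: 'I_n.+1])
   (fun v : 'rV[R]_n.+1 => v ord0 i : measurableTypeR R) @^-1`
     `[a ord0 i, b ord0 i]%classic); last first.
  by apply/seteqP; split => [v h i _|v h i]; exact: h.
apply: fin_bigcap_measurable => // i _; rewrite -[X in measurable X]setTI.
exact: measurable_coord.
Qed.

Lemma lebesgue_rV_open_gt0 (A : set 'rV[R]_n.+1) : open A -> A !=set0 ->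
  (0 < mu A)%E.
Proof.
move=> oA [x Ax].
have /nbhs_ballP[e /= e0 eA] : nbhs x A by exact: open_nbhs_nbhs.
pose a : 'rV[R]_n.+1 := \row_i (x ord0 i - e / 2).
pose b : 'rV[R]_n.+1 := \row_i (x ord0 i + e / 2).
have ab i : a ord0 i <= b ord0 i by rewrite !mxE; lra.
have := lebesgue_rV_box ab.
have -> : \prod_(i < n.+1) (b ord0 i - a ord0 i) = e ^+ n.+1.
  rewrite (eq_bigr (fun=> e)); first by rewrite prodr_const card_ord.
  by move=> i _; rewrite !mxE; lra.
move=> boxE; apply: (@lt_le_trans _ _ (e ^+ n.+1)%:E); first by rewrite lte_fin exprn_gt0.
rewrite -boxE; apply: le_measure; rewrite ?inE.
- exact: measurable_rV_box.
- exact: open_measurable_mx.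
- move=> v /= vab; apply: eA; split=> // i j; rewrite /ball/= (ord1 i).
  have := vab j; rewrite !mxE in_itv/= => /andP[h1 h2].
  by rewrite ltr_norml; apply/andP; split; lra.
Qed.

Lemma bounded_set_coord (A : set 'rV[R]_n.+1) : bounded_set A ->
  exists2 M : R, 0 < M & forall x, A x -> forall i, `|x ord0 i| < M.
Proof.
move=> [M [Mreal MA]]; exists (`|M| + 2); first by rewrite ltr_wpDl.
move=> x Ax i; apply: (le_lt_trans (ler_mx_coord x ord0 i)).
apply: (@le_lt_trans _ _ (`|M| + 1)); last by rewrite ltrD2l ltr1n.
by apply: (MA _ _ x Ax); rewrite (le_lt_trans (ler_norm _))// ltrDl.
Qed.

(** The first coordinate has a law with bounded density on a bounded set. *)
Lemma lebesgue_rV_slab (A : set 'rV[R]_n.+1) (M s t : R) : measurable A ->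
  (forall x, A x -> forall i, `|x ord0 i| < M) -> 0 < M -> s <= t ->
  (mu (A `&` [set x | (s <= x ord0 ord0 < t)%R]) <=
   ((M *+ 2) ^+ n * (t - s))%:E)%E.
Proof.
move=> mA AM M0 st.
(* The intersection lies in a box whose first side is [s, t] and whose other sides
   are [- M, M]. *)
pose a : 'rV[R]_n.+1 := \row_i (if i == ord0 then s else - M).
pose b : 'rV[R]_n.+1 := \row_i (if i == ord0 then t else M).
have ab i : a ord0 i <= b ord0 i by rewrite !mxE; case: ifP => //; lra.
have := lebesgue_rV_box ab.
have -> : \prod_(i < n.+1) (b ord0 i - a ord0 i) = (M *+ 2) ^+ n * (t - s).
  rewrite big_ord_recl !mxE /= mulrC (eq_bigr (fun=> M *+ 2)).
    by rewrite prodr_const card_ord.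
  by move=> i _; rewrite !mxE /= opprK mulr2n.
move=> <-; apply: le_measure; rewrite ?inE.
- apply: measurableI => //.
  have mc : measurable_fun [set: 'rV[R]_n.+1] (fun x => x ord0 ord0 : R).
    exact: measurable_coord.
  have := mc measurableT _ (measurable_itv `[s, t[); rewrite setTI.
  by congr measurable; apply/seteqP; split => x /=; rewrite in_itv.
- exact: measurable_rV_box.
- move=> x [Ax /= /andP[sx /ltW xt]] i; rewrite !mxE in_itv/=.
  case: eqP => [->|_]; first by rewrite sx xt.
  by have := AM x Ax i; rewrite ltr_norml => /andP[/ltW -> /ltW ->].
Qed.

Lemma lebesgue_rV_bounded (A : set 'rV[R]_n.+1) : measurable A -> bounded_set A ->
  (mu A < +oo)%E.
Proof.
move=> mA /bounded_set_coord[M M0 AM].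
have MM : - M <= M by lra.
apply: le_lt_trans (ltry ((M *+ 2) ^+ n * (M - (- M)))).
apply: le_trans (lebesgue_rV_slab mA AM M0 MM); rewrite le_eqVlt; apply/orP; left.
apply/eqP; congr (mu _); apply/seteqP; split => [x Ax|x []//]; split => //=.
by have := AM x Ax ord0; rewrite ltr_norml => /andP[/ltW -> ->].
Qed.

(** An enumeration of the open half-spaces where a coordinate is below a rational
    level; indices that encode no such half-space give the empty set. *)
Definition rat_halfspace (k : nat) : set 'rV[R]_n.+1 :=
  if unpickle k is Some (i, q) then [set x | x ord0 (i : 'I_n.+1) < ratr q] else set0.

Lemma measurable_rat_halfspace k : measurable (rat_halfspace k).
Proof.
rewrite /rat_halfspace; case: unpickle => [[i q]|] //.
have mc : measurable_fun [set: 'rV[R]_n.+1] (fun x => x ord0 i : R).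
  exact: measurable_coord.
have := mc measurableT _ (measurable_itv `]-oo, (ratr q)[); rewrite setTI.
by congr measurable; apply/seteqP; split => x /=; rewrite in_itv.
Qed.

(** The Borel sigma-algebra is generated by countably many half-spaces: the
    identity is measurable from the sigma-algebra they generate, since its
    coordinates are. *)
Lemma measurable_rV_gen :
  @measurable _ 'rV[R]_n.+1 = <<s range rat_halfspace >>.
Proof.
apply/seteqP; split; last first.
  apply: smallest_sub; first exact: sigma_algebra_measurable.
  by move=> _ [k _ <-]; exact: measurable_rat_halfspace.
pose T := g_sigma_algebraType (range rat_halfspace).
have mid : measurable_fun [set: T] (fun x : T => x : 'rV[R]_n.+1).
  apply/measurable_fun_mxP => i j; rewrite (ord1 i).
  apply: (measurability _ (RGenInftyO.measurableE R)).
  move=> _ [_ [x ->] <-]; rewrite setTI.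
  rewrite (_ : _ @^-1` _ = \bigcup_(q in [set q : rat | ratr q <= x])
     rat_halfspace (pickle (j, q))).
    rewrite bigcup_mkcond; apply: countable_bigcupT_measurable => // q.
    by case: ifP => // _; apply: sub_sigma_algebra; exists (pickle (j, q)).
  apply/seteqP; split => v /=; rewrite /rat_halfspace.
    rewrite in_itv/= => vx; have [q] := rat_in_itvoo vx.
    by rewrite in_itv/= => /andP[vq /ltW qx]; exists q => //; rewrite pickleK.
  by move=> [q /= qx]; rewrite pickleK /= in_itv/= => /lt_le_trans; apply.
by move=> A mA; have := mid measurableT A mA; rewrite setTI.
Qed.

End euclidean_space.

Theorem theorem1p3 (R : realType) (n : nat) (n_gt0 : (0 < n)%N)
    (Omega : set 'rV[R]_n) (Omega_neq0 : Omega !=set0)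
    (Omega_bounded : bounded_set Omega) (Omega_open : open Omega)
    (W : R * R -> R) (W_lsc : lower_semicontinuous (EFin \o W))
    (W_coercive : coercive W) :
  let mu := lebesgue_rV n in
  let J := supremal mu Omega (EFin \o W) in
  (weak_star_lsc mu Omega J <->
     separately_level_convex (EFin \o diag_sym W)) /\
  (exists2 Wslc : R * R -> \bar R,
     slc_envelope (EFin \o diag_sym W) Wslc &
     forall u : 'rV[R]_n -> R, Linfty mu Omega u ->
       relaxation mu Omega J u = supremal mu Omega Wslc u).
Proof.
case: n n_gt0 Omega Omega_neq0 Omega_bounded Omega_open => // n _ Omega O0 Ob Oo mu J.
have mO : measurable Omega by exact: open_measurable_mx.
have Ofin := lebesgue_rV_bounded mO Ob.
have Opos := lebesgue_rV_open_gt0 Oo O0.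
have [M M0 OM] := bounded_set_coord Ob.
have mf : measurable_fun [set: 'rV[R]_n.+1] (fun x => x ord0 ord0 : R).
  exact: measurable_coord.
have MM : - M <= M by lra.
have fM x : Omega x -> - M <= x ord0 ord0 < M.
  by move=> Ox; have := OM x Ox ord0; rewrite ltr_norml => /andP[/ltW -> ->].
have slab s t (st : s <= t) := lebesgue_rV_slab mO OM M0 st.
split.
  exact: (weak_star_lsc_supremal mO Ofin Opos mf MM fM slab
    (@measurable_rat_halfspace R n) (measurable_rV_gen n) W_lsc W_coercive).
exists (square_envelope (diag_sym W)); first exact: square_envelopeP.
move=> u uL.
exact: (relaxation_supremal mO Ofin Opos mf MM fM slab
  (@measurable_rat_halfspace R n) (measurable_rV_gen n) W_lsc W_coercive uL).
Qed.
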